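(* Let $(V,W_\bullet,F'^\bullet,F''^\bullet)$ be a complex mixed Hodge structure, and let $(E,\nabla)$ be the corresponding $\mathbb G_m^2$-equivariant bundle with connection on $\mathbb A^2$. Then, under the identification $E_{(0,0)}=\mathrm{gr}^{\bullet\bullet}(V)$ of the fiber of $E$ at the origin, the Deligne operator $$\delta:\ E_{(0,0)}=\mathrm{gr}^{\bullet\bullet}(V)\to\mathrm{gr}^{\bullet\bullet}(V)=E_{(0,0)}$$ is recovered as the holonomy of $\nabla$ along the boundary of the triangle with vertices $(0,0)$, $(-1,0)$, $(0,-1)$.
   Context: A complex mixed Hodge structure is a finite-dimensional complex vector space $V$ with an increasing filtration $W_\bullet$ and two decreasing filtrations $F'^\bullet,F''^\bullet$ (finite, exhaustive, separated) such that $\mathrm{gr}^p_{F'}\mathrm{gr}^q_{F''}\mathrm{gr}^W_n(V)=0$ for $n\neq p+q$; they form the category $\mathrm{MHS}_{\mathbb C}$. Write $\mathrm{gr}^{p,q}(V)=\mathrm{gr}^p_{F'}\mathrm{gr}^q_{F''}\mathrm{gr}^W_{p+q}(V)$; then $\mathrm{gr}^W_\bullet(V)=\mathrm{gr}^{\bullet\bullet}(V)=\bigoplus_{p,q}\mathrm{gr}^{p,q}(V)$, where for $n=p+q$, $\mathrm{gr}^{p,q}(V)$ is identified with the subspace $F'^p\cap F''^q$ of $\mathrm{gr}^W_n(V)$ (induced filtrations). Deligne operator. There are two splittings $V=\bigoplus_{p,q}V_{F'}^{p,q}=\bigoplus_{p,q}V_{F''}^{p,q}$ due to Deligne: with $n=p+q$,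 $$V_{F'}^{p,q}=W_n\cap F'^p\cap\Bigl(W_n\cap F''^q+\sum_{i\ge2}W_{n-i}\cap F''^{q-i+1}\Bigr),\qquad V_{F''}^{p,q}=W_n\cap F''^q\cap\Bigl(W_n\cap F'^p+\sum_{i\ge2}W_{n-i}\cap F'^{p-i+1}\Bigr).$$ Both split $W$: $W_n=\bigoplus_{p+q\le n}V_{F'}^{p,q}=\bigoplus_{p+q\le n}V_{F''}^{p,q}$; the first splits $F'$: $F'^p=\bigoplus_{p'\ge p,\,q}V_{F'}^{p',q}$; the second splits $F''$: $F''^q=\bigoplus_{p,\,q'\ge q}V_{F''}^{p,q'}$. The projections $V^{p,q}_{F'}\to\mathrm{gr}^{p,q}(V)$ and $V^{p,q}_{F''}\to\mathrm{gr}^{p,q}(V)$ are isomorphisms; their direct sums are isomorphisms $a_{F'},a_{F''}:V\to\mathrm{gr}^{\bullet\bullet}(V)$. The Deligne operator is $\delta=a_{F''}a_{F'}^{-1}$; it satisfies $(\delta-1)(\mathrm{gr}^{p,q}(V))\subset\bigoplus_{p'<p,\,q'<q}\mathrm{gr}^{p',q'}(V)$. The corresponding bundle with connection. $\mathbb A^2=\mathrm{Spec}\,\mathbb C[t_1,t_2]$ has the diagonal $\mathbb G_m^2$-action. $\mathrm{Bun}_\nabla(\mathbb A^2;\mathbb G_m^2)$ is the category of $\mathbb G_m^2$-equivariant algebraic vector bundles on $\mathbb A^2$ with invariant algebraic connection (not necessarily flat). Let $\check{\mathbb P}^2=\mathrm{Proj}\,\mathbb C[v_0,v_1,v_2]$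 and $\check{\mathbb P}^2_0=\check{\mathbb P}^2-\{[1:0:0]\}$, where $[v_0:v_1:v_2]\in\check{\mathbb P}^2_0$ parametrizes the line $v_0+v_1t_1+v_2t_2=0$ in $\mathbb A^2$; $\mathbb G_m^2$ acts on $\check{\mathbb P}^2$ by the dual action. (1) The Rees bundle of $V$ is the sheaf $\mathcal E$ on $\check{\mathbb P}^2$ associated with the graded $\mathbb C[v_0,v_1,v_2]$-module $\bigoplus_{i,j,k}(W_i\cap F'^{-j}\cap F''^{-k})(V)\,v_0^iv_1^jv_2^k\subset V[v_0^{\pm1},v_1^{\pm1},v_2^{\pm1}]$ (graded by total degree); it is a vector bundle, equivariant under $\mathbb G_m^2=\mathbb G_m^3/\mathbb G_m$ via the $\mathbb Z^3$-grading. (2) The Radon–Penrose transform of $(E,\nabla)$ is the equivariant bundle $p_{0*}^\nabla(q_0^*E)$ on $\check{\mathbb P}^2_0$, where $Q_0\subset\mathbb A^2\times\check{\mathbb P}^2_0$ is the point-line incidence variety with projections $q_0,p_0$, and $p_{0*}^\nabla$ means sections of the direct image covariantly constant along the fibers of $p_0$; its fiber at a line $l$ is $H^0_\nabla(l,E)$. The object $(E,\nabla)$ corresponding to $V$ is the one, unique up to isomorphism, whose Radon–Penrose transform is $\mathcal E|_{\check{\mathbb P}^2_0}$; this gives an equivalence $\mathrm{MHS}_{\mathbb C}\simeq\mathrm{Bun}_\nabla(\mathbb A^2;\mathbb G_m^2)$. Identification of the fiber at the origin. For $x\in\mathbb A^2$ let $\lambda_x\subset\check{\mathbb P}^2_0$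 be the projective line of lines through $x$; restricting covariantly constant sections to $x$ gives $\mathcal E|_{\lambda_x}\cong\mathcal O\otimes E_x$, so $E_x=H^0(\lambda_x,\mathcal E)$. For $x=(0,0)$, $\lambda_x=\{v_0=0\}$, and the Rees construction gives $\mathcal E|_{\{v_0=0\}}\cong\mathrm{gr}^W_\bullet(V)\otimes\mathcal O$, where $w\in\mathrm{gr}^{p,q}(V)\subset\mathrm{gr}^W_{p+q}(V)$ corresponds to the section $w\,v_0^{p+q}v_1^{-p}v_2^{-q}$ (i.e. locally the class of a lift of $w$ times this monomial). Hence $E_{(0,0)}=\mathrm{gr}^W_\bullet(V)=\mathrm{gr}^{\bullet\bullet}(V)$. *)

(* Defs.v *)
From HB Require Import structures.
From mathcomp Require Import all_boot all_order all_algebra.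
From mathcomp Require Import generic_quotient ring_quotient.
From mathcomp Require Import complex.
From mathcomp Require Import boolp classical_sets functions cardinality fsbigop.
From mathcomp Require Import reals topology normedtype derive.

Set Implicit Arguments.
Unset Strict Implicit.
Unset Printing Implicit Defensive.

Import Order.TTheory GRing.Theory Num.Theory.
Import numFieldNormedType.Exports.

Local Open Scope classical_set_scope.
Local Open Scope ring_scope.
Local Open Scope quotient_scope.

Section Decompositions.
Variables (I : choiceType) (A : zmodType).

Definition finsupp (u : I -> A) : Prop := finite_set [set i | u i != 0].

Definition is_decomposition (P : I -> set A) (v : A) (u : I -> A) : Prop :=
  [/\ forall i, P i (u i), finsupp u & v = \sum_(i \in [set: I]) u i].

End Decompositions.

Section Quotients.
Variables (K : fieldType) (V : vectType K).

(* V / U is realized on MathComp's complement U^C: the class of v is the unique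
   element of U^C congruent to v modulo U.  Classes in different quotients of V
   thus all live in V. *)
Definition cls (U : {vspace V}) : 'End(V) := (\1 - projv U)%VF.

Lemma cls_mem (U : {vspace V}) v : cls U v \in (U^C)%VS.
Proof. by rewrite !lfunE /= !lfunE /=; exact: memv_projC. Qed.

Lemma cls_eq (U : {vspace V}) v w : (cls U v == cls U w) = (v - w \in U).
Proof.
rewrite -subr_eq0 -linearB /= !lfunE /= !lfunE /= subr_eq0.
by apply/eqP/idP => [->|/projv_id->//]; exact: memv_proj.
Qed.

(* The filtration step induced on the subquotient A / B by a subspace X. *)
Definition induced (A B X : {vspace V}) : {vspace V} :=
  (cls B @: (A :&: X))%VS.

End Quotients.

Section GradedPieces.
Variables (K : fieldType) (V : vectType K).

Definition grW_fil (W F : int -> {vspace V}) (n p : int) : {vspace V} := induced (W n) (W (n - 1)) (F p).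

(* The step p of the filtration induced by F' on gr^q_{F''} gr^W_n. *)
Definition gr2_fil (W F' F'' : int -> {vspace V}) (n q p : int) : {vspace V} :=
  induced (grW_fil W F'' n q) (grW_fil W F'' n (q + 1)) (grW_fil W F' n p).

(* gr^p_{F'} gr^q_{F''} gr^W_n *)
Definition gr3 (W F' F'' : int -> {vspace V}) (p q n : int) : {vspace V} :=
  induced (gr2_fil W F' F'' n q p) (gr2_fil W F' F'' n q (p + 1)) fullv.

End GradedPieces.

Record mhs (K : fieldType) := Mhs {
  mhs_sort :> vectType K;
  weight : int -> {vspace mhs_sort};
  hodge1 : int -> {vspace mhs_sort};
  hodge2 : int -> {vspace mhs_sort};
  weight_incr : forall n, (weight n <= weight (n + 1))%VS;
  hodge1_decr : forall p, (hodge1 (p + 1) <= hodge1 p)%VS;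
  hodge2_decr : forall q, (hodge2 (q + 1) <= hodge2 q)%VS;
  weight_finite : exists N : nat,
    weight (- N%:Z) = 0%VS /\ weight N%:Z = fullv;
  hodge1_finite : exists N : nat,
    hodge1 (- N%:Z) = fullv /\ hodge1 N%:Z = 0%VS;
  hodge2_finite : exists N : nat,
    hodge2 (- N%:Z) = fullv /\ hodge2 N%:Z = 0%VS;
  mhs_pure : forall n p q, n != p + q ->
    gr3 weight hodge1 hodge2 p q n = 0%VS }.

Section DeligneOperator.
Variables (K : fieldType) (V : mhs K).
Local Notation W := (@weight K V).
Local Notation F' := (@hodge1 K V).
Local Notation F'' := (@hodge2 K V).

(* gr^{p,q}, as the subspace F'^p :&: F''^q of gr^W_{p+q}. *)
Definition grpq (pq : int * int) : {vspace V} :=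
  (grW_fil W F' (pq.1 + pq.2) pq.1 :&: grW_fil W F'' (pq.1 + pq.2) pq.2)%VS.

(* gr^{..} as families of elements of the gr^{p,q}; all but finitely many
   of these spaces vanish, so that product and direct sum agree. *)
Definition gr_bigraded : set (int * int -> V) :=
  [set w | forall pq, w pq \in grpq pq].

(* For n = p + q: W_n :&: A^p :&: (W_n :&: B^q + \sum_{i >= 2} W_{n-i} :&:
   B^{q-i+1}), the infinite sum being the union of its partial sums. *)
Definition deligne_piece (A B : int -> {vspace V}) (p q : int) : set V :=
  [set v | v \in (W (p + q)%R :&: A p)%VS /\
    exists N : nat, v \in (W (p + q)%R :&: B q +
      \sum_(2 <= i < N) (W (p + q - i%:Z)%R :&: B (q - i%:Z + 1)%R))%VS].

Definition split1 (pq : int * int) : set V := deligne_piece F' F'' pq.1 pq.2.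
Definition split2 (pq : int * int) : set V := deligne_piece F'' F' pq.2 pq.1.

Definition to_gr (u : int * int -> V) : int * int -> V :=
  fun pq => cls (W (pq.1 + pq.2 - 1)) (u pq).

(* Graphs of the isomorphisms a_{F'} and a_{F''} from V to gr^{..}. *)
Definition a1 (v : V) (w : int * int -> V) : Prop :=
  exists2 u, is_decomposition split1 v u & w = to_gr u.
Definition a2 (v : V) (w : int * int -> V) : Prop :=
  exists2 u, is_decomposition split2 v u & w = to_gr u.

(* Graph of delta = a_{F''} o a_{F'}^{-1}: "w' = delta w". *)
Definition deligne_operator (w w' : int * int -> V) : Prop :=
  exists2 v, a1 v w & a2 v w'.

End DeligneOperator.

(* C[t_1, t_2] is {poly {poly K}} with t_1 = 'X and t_2 = 'Y, so that f(x, y) is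
   f.[x, y]. *)
Section BundlesOnThePlane.
Variable K : fieldType.
Local Notation A := {poly {poly K}}.

Definition cst (c : K) : A := c%:P%:P.
Definition d1 (f : A) : A := f^`().
Definition d2 (f : A) : A := map_poly (fun g : {poly K} => g^`()) f.

(* Bun_nabla(A^2; G_m^2).  An algebraic vector bundle is a finitely generated
   projective module of sections.  As dt_1, dt_2 is a basis of the 1-forms, a
   connection is the pair of its covariant derivatives along d/dt_1, d/dt_2.
   A G_m^2-equivariant structure is a Z^2-grading by weights, in which we let
   t_1, t_2 have weights (1,0), (0,1); for an invariant connection d/dt_1, d/dt_2
   then lower the weight by (1,0), (0,1). *)
Record eqbun := Eqbun {
  eqbun_sort :> lmodType A;
  eqbun_projective : exists (r : nat)
    (f : {linear eqbun_sort -> 'rV[A]_r}) (g : {linear 'rV[A]_r -> eqbun_sort}),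
    cancel f g;
  nabla1 : eqbun_sort -> eqbun_sort;
  nabla2 : eqbun_sort -> eqbun_sort;
  nabla1D : forall m m', nabla1 (m + m') = nabla1 m + nabla1 m';
  nabla2D : forall m m', nabla2 (m + m') = nabla2 m + nabla2 m';
  nabla1Z : forall f m, nabla1 (f *: m) = d1 f *: m + f *: nabla1 m;
  nabla2Z : forall f m, nabla2 (f *: m) = d2 f *: m + f *: nabla2 m;
  homog : int * int -> set eqbun_sort;
  homog0 : forall ab, homog ab 0;
  homogP : forall ab c m m',
    homog ab m -> homog ab m' -> homog ab (cst c *: m + m');
  homog_unique : forall m, exists! u, is_decomposition homog m u;
  homog_t1 : forall a b m, homog (a, b) m -> homog (a + 1, b) ('X *: m);
  homog_t2 : forall a b m, homog (a, b) m -> homog (a, b + 1) ('Y *: m);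
  homog_nabla1 : forall a b m, homog (a, b) m -> homog (a - 1, b) (nabla1 m);
  homog_nabla2 : forall a b m, homog (a, b) m -> homog (a, b - 1) (nabla2 m) }.

Section Fibers.
Variables (E : eqbun) (x : K * K).

Definition vanishing : {pred E} := fun m =>
  `[< exists m1 m2, m = ('X - cst x.1) *: m1 + ('Y - cst x.2) *: m2 >].

Fact vanishing_zmod_closed : zmod_closed vanishing.
Proof.
split=> [|m m'].
  by apply/asboolP; exists 0, 0; rewrite !scaler0 addr0.
move=> /asboolP[m1 [m2 ->]] /asboolP[m1' [m2' ->]].
apply/asboolP; exists (m1 - m1'), (m2 - m2').
by rewrite !scalerBr opprD addrACA.
Qed.

HB.instance Definition _ := GRing.isZmodClosed.Build E vanishing
  vanishing_zmod_closed.

(* E_x = E / m_x E *)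
Definition fiber : zmodType := Quotient.quot vanishing.

Definition value (m : E) : fiber := \pi_(Quotient.quot vanishing) m.

End Fibers.
End BundlesOnThePlane.

(* P^2_0 is covered by the affine open sets v_1 != 0 and v_2 != 0. *)
Variant chart := U1 | U2 | U12.

(* The exponents of v_1, v_2 in the monomial (v_1, v_2, resp. v_1 v_2) whose
   non-vanishing defines a chart. *)
Definition chart_exp (U : chart) : nat * nat :=
  match U with U1 => (1, 0) | U2 => (0, 1) | U12 => (1, 1) end.

Section ReesBundle.
Variables (K : fieldType) (V : mhs K).

(* x : int * int * int -> V stands for \sum x_{ijk} v_0^i v_1^j v_2^k. *)
Definition rees_module (x : int * int * int -> V) : Prop :=
  finsupp x /\ forall i j k,
    x (i, j, k) \in (weight V i :&: hodge1 V (- j) :&: hodge2 V (- k))%VS.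

(* Multiplication by v_1^a v_2^b. *)
Definition mul_mon (a b : int) (x : int * int * int -> V) : int * int * int -> V :=
  fun ijk => x (ijk.1.1, ijk.1.2 - a, ijk.2 - b).

(* Sections over a chart: degree zero part of the localized Rees module.
   The restriction maps to U12 are
   inclusions of sets of Laurent polynomials. *)
Definition rees_section (U : chart) (x : int * int * int -> V) : Prop :=
  (forall ijk, x ijk != 0 -> ijk.1.1 + ijk.1.2 + ijk.2 = 0) /\
  exists N : nat, rees_module
    (mul_mon (N * (chart_exp U).1)%:Z (N * (chart_exp U).2)%:Z x).

(* The weight under G_m^2 is normalized as for eqbun: v_1 t_1 and v_2 t_2 have
   the same weight as v_0, so v_0^i v_1^j v_2^k has weight (-j, -k). *)
Definition rees_weight (ab : int * int) (x : int * int * int -> V) : Prop :=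
  forall i j k, x (i, j, k) != 0 -> (- j, - k) = ab.

End ReesBundle.

Section RadonPenrose.
Variables (K : fieldType) (E : eqbun K).

(* On Q_0 one has v_0 = - v_1 t_1 - v_2 t_2; eliminating v_0, sections of q_0^*E
   over the inverse image of a chart are Laurent polynomials
   \sum s_{jk} v_1^j v_2^k of total degree zero with coefficients in E.  The
   fibers of p_0 are the curves with v constant, tangent to
   v_1 d/dt_2 - v_2 d/dt_1. *)
Definition rp_section (U : chart) (s : int * int -> E) : Prop :=
  [/\ finsupp s,
      forall jk, s jk != 0 -> jk.1 + jk.2 = 0,
      exists N : nat, forall jk, s jk != 0 ->
        0 <= jk.1 + (N * (chart_exp U).1)%:Z /\
        0 <= jk.2 + (N * (chart_exp U).2)%:Z
    & forall j k, nabla2 (s (j - 1, k)) - nabla1 (s (j, k - 1)) = 0].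

(* m v_1^j v_2^k has weight (a - j, b - k) for m of weight (a, b). *)
Definition rp_weight (ab : int * int) (s : int * int -> E) : Prop :=
  forall j k, homog (ab.1 + j, ab.2 + k) (s (j, k)).

(* Multiplication by v_0 / v_1. *)
Definition rp_mul_v0v1 (s : int * int -> E) : int * int -> E :=
  fun jk => - ('X *: s jk + 'Y *: s (jk.1 + 1, jk.2 - 1)).

End RadonPenrose.

Section Correspondence.
Variables (K : fieldType) (V : mhs K) (E : eqbun K).

(* Equivariant isomorphism from the Radon-Penrose transform of E to the
   restriction to P^2_0 of the Rees bundle of V, given by its effect on sections
   over U12 (values of Phi outside rp_section U12 are irrelevant).  Functions on
   U12 are generated by K, (v_2/v_1)^{+-1} and v_0/v_1. *)
Record rees_iso (Phi : (int * int -> E) -> (int * int * int -> V)) : Prop := {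
  rees_isoD : forall s s', rp_section U12 s -> rp_section U12 s' ->
    Phi (fun jk => s jk + s' jk) = (fun ijk => Phi s ijk + Phi s' ijk);
  rees_isoZ : forall c s, rp_section U12 s ->
    Phi (fun jk => cst c *: s jk) = (fun ijk => c *: Phi s ijk);
  rees_iso_v2v1 : forall s, rp_section U12 s ->
    Phi (fun jk => s (jk.1 + 1, jk.2 - 1)) = mul_mon (- 1) 1 (Phi s);
  rees_iso_v0v1 : forall s, rp_section U12 s ->
    Phi (rp_mul_v0v1 s) =
      (fun ijk => Phi s (ijk.1.1 - 1, ijk.1.2 + 1, ijk.2));
  rees_iso_section : forall U s, rp_section U s -> rees_section U (Phi s);
  rees_iso_inj : forall s s', rp_section U12 s -> rp_section U12 s' ->
    Phi s = Phi s' -> s = s';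
  rees_iso_surj : forall U x, rees_section U x ->
    exists2 s, rp_section U s & Phi s = x;
  rees_iso_weight : forall ab s, rp_section U12 s ->
    rp_weight ab s -> rees_weight ab (Phi s) }.

(* The identification iota : E_{(0,0)} -> gr^{..} induced by Phi is the map that
   intertwines the two trivializations over \lambda_0 = {v_0 = 0}.
   - On the Radon-Penrose side s restricts to
       \sum value(s_{jk}) v_1^j v_2^k in E_{(0,0)} (x) O.
   - On the Rees side x restricts to \sum [x_{ijk}] v_1^j v_2^k, with [x_{ijk}] in
     gr^W_i, and w in gr^{p,q} gives the section w v_0^{p+q} v_1^{-p} v_2^{-q}.
   So \sum e_{jk} v_1^j v_2^k corresponds to
       \sum iota(e_{jk})_{pq} v_0^{p+q} v_1^{j-p} v_2^{k-q};
   the formula equates the coefficients in gr^W_i of v_1^j v_2^k. *)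
Definition fiber_identification
    (Phi : (int * int -> E) -> (int * int * int -> V))
    (iota : fiber E (0, 0) -> (int * int -> V)) : Prop :=
  (forall e, gr_bigraded (iota e)) /\
  forall s, rp_section U12 s -> forall i j k, i + j + k = 0 ->
    cls (weight V (i - 1)) (Phi s (i, j, k)) =
    \sum_(p \in [set: int])
      iota (value (0, 0) (s (j + p, k + (i - p)))) (p, i - p).

End Correspondence.

Section Holonomy.
Variables (R : realType) (E : eqbun R[i]).
Local Notation C := R[i].

Definition is_derive_C (f df : R -> C) (s : R) : Prop :=
  is_derive s 1 (fun u => complex.Re (f u)) (complex.Re (df s)) /\
  is_derive s 1 (fun u => complex.Im (f u)) (complex.Im (df s)).

Definition segment (x y : C * C) (s : R) : C * C :=
  (x.1 + (s%:C)%C * (y.1 - x.1), x.2 + (s%:C)%C * (y.2 - x.2)).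

(* "e' is the parallel transport of e along the segment from x to y".
   A differentiable section along a curve gamma is
   s |-> \sum_l f_l(s) m_l(gamma(s)), with m_l global sections and f_l
   differentiable functions of s. *)
Definition transport (x y : C * C) (e : fiber E x) (e' : fiber E y) : Prop :=
  exists (r : nat) (m : 'I_r -> E) (f df : 'I_r -> R -> C),
    [/\ forall l s, 0 <= s <= 1 -> is_derive_C (f l) (df l) s,
        forall s, 0 <= s <= 1 ->
          value (segment x y s)
            (\sum_l (cst (df l s) *: m l +
               cst (f l s) *: (cst (y.1 - x.1) *: nabla1 (m l) +
                               cst (y.2 - x.2) *: nabla2 (m l)))) = 0,
        e = value x (\sum_l cst (f l 0) *: m l)
      & e' = value y (\sum_l cst (f l 1) *: m l)].

(* "e' is the holonomy of e along the closed path x -> y -> z -> x". *)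
Definition triangle_holonomy (x y z : C * C) (e e' : fiber E x) : Prop :=
  exists (ey : fiber E y) (ez : fiber E z),
    [/\ transport e ey, transport ey ez & transport ez e'].

End Holonomy.

(* Main.v *)
From mathcomp Require Import all_boot all_order all_algebra.
From mathcomp Require Import generic_quotient ring_quotient.
From mathcomp Require Import complex reals.
From mathcomp Require Import boolp classical_sets functions cardinality fsbigop.
From mathcomp Require Import topology normedtype derive.
From mathcomp Require Import zify ring.
Require Import Defs.

(* For n = p + q, an element v of V^{p,q}_{F'} gives the section
   v v_0^n v_1^-p v_2^-q of the Rees bundle, regular at v_1 = 0.  Writing
   v = u_0 + \sum_{i >= 2} u_i as in Deligne's definition, it coincides on the
   projective line v_0 = v_2 of lines through (0,-1) with
   \sum_i u_i v_0^(n-i) v_1^-p v_2^(i-q), which is regular at v_2 = 0.  So v defines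
   an element of the fiber of E at (0,-1).  At the line t_1 = 0, i.e. at v_2 = 0, only
   u_0 survives on the graded level, so this element is the parallel transport of
   the class of v in gr^{p,q}.  Hence transport from (0,0) to (0,-1) is the inverse of
   a_{F'}, where the flat sections along the line t_1 + t_2 = -1 are identified with V.
   Symmetrically, transport from (-1,0) to (0,0) is a_{F''}.

   Parallel transport along a line is algebraic: the weights of E are bounded below,
   so covariant derivatives are locally nilpotent and E is generated by flat
   sections over the functions of an affine coordinate of the line. *)

Set Implicit Arguments.
Unset Strict Implicit.
Unset Printing Implicit Defensive.

Import Order.TTheory GRing.Theory Num.Theory.
Import numFieldNormedType.Exports.
Local Open Scope classical_set_scope.
Local Open Scope ring_scope.

(** * Finite sums *)

(** The line t_1 + t_2 = -1 is the point v = (1,1,1) of the dual plane, where every monomial has the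
    value 1. A vector of V therefore gives the same flat section there whatever exponents carry it,
    which is how the two splittings, using different monomials, are glued along the third side.

    The connection may have curvature, so directions are treated one at a time: a flat section along
    a side is represented by a global element of E killed by the derivative in that constant
    direction.

    Holonomy and Deligne operator are both relations. Each implication needs [iota] to be injective;
    this is not assumed but follows from the surjectivity of [Phi], since a section trivial on the
    graded level is divisible by v_0. The passage from holonomy to the Deligne operator also needs
    the existence of the splittings and the uniqueness of transport. As the coefficients in
    [transport] are merely differentiable functions, uniqueness ends in a mean value argument. *)

Section FiniteSums.
Variables (I : choiceType) (A : zmodType).
Implicit Types (u : I -> A) (r : seq I).

Lemma fsum_seq u r : uniq r -> (forall i, i \notin r -> u i = 0) ->
  \sum_(i \in [set: I]) u i = \sum_(i <- r) u i.
Proof.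
move=> ur u0; rewrite (fsbigE r) //; last by move=> i _; exact: u0.
by apply: eq_bigl => i; rewrite in_setT.
Qed.

Lemma finsupp_seq u : finsupp u ->
  exists2 r, uniq r & forall i, i \notin r -> u i = 0.
Proof.
move=> /finite_seqP[s us]; exists (undup s); first exact: undup_uniq.
move=> i; rewrite mem_undup => si; apply/eqP; apply: contraNT si => ui.
by have : [set i | u i != 0] i by []; rewrite us.
Qed.

Lemma seq_finsupp u r : (forall i, i \notin r -> u i = 0) -> finsupp u.
Proof.
move=> ur; apply: (sub_finite_set _ (finite_seq r)) => i /=.
by apply: contraNT => /ur ->.
Qed.

Lemma finsuppD u v : finsupp u -> finsupp v -> finsupp (fun i => u i + v i).
Proof.
move=> /finsupp_seq[r _ ur] /finsupp_seq[s _ vs].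
apply: (@seq_finsupp _ (r ++ s)) => i; rewrite mem_cat negb_or => /andP[ri si].
by rewrite ur // vs // addr0.
Qed.

Lemma fsumD u v : finsupp u -> finsupp v ->
  \sum_(i \in [set: I]) (u i + v i) =
  \sum_(i \in [set: I]) u i + \sum_(i \in [set: I]) v i.
Proof.
move=> /finsupp_seq[r _ ur] /finsupp_seq[s _ vs].
pose t := undup (r ++ s).
have it i : i \notin t -> i \notin r /\ i \notin s.
  by rewrite mem_undup mem_cat negb_or => /andP[].
rewrite !(@fsum_seq _ t) ?undup_uniq ?big_split // => i /it[ri si].
- exact: vs.
- exact: ur.
- by rewrite ur // vs // addr0.
Qed.

Lemma fsum_delta i (a : A) :
  \sum_(j \in [set: I]) (if j == i then a else 0) = a.
Proof.
rewrite (@fsum_seq _ [:: i]) ?big_seq1 ?eqxx // => j.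
by rewrite mem_seq1 => /negPf ->.
Qed.

(** Inductive constructions produce lists of pieces in which an index may recur; grouping the
    entries by index makes a decomposition of them. *)
Lemma decomposition_of_seq (P : I -> set A) (s : seq (I * A)) :
    (forall i, P i 0) -> (forall i a b, P i a -> P i b -> P i (a + b)) ->
    (forall x, x \in s -> P x.1 x.2) ->
  is_decomposition P (\sum_(x <- s) x.2)
    (fun i => \sum_(x <- s | x.1 == i) x.2).
Proof.
move=> P0 PD Ps; pose u i := \sum_(x <- s | x.1 == i) x.2; rewrite -/u.
have u0 i : i \notin undup (map fst s) -> u i = 0.
  rewrite mem_undup => si; rewrite /u big_seq_cond big1 // => x /andP[xs /eqP xi].
  by move/negP: si; case; rewrite -xi; exact: map_f.
split.
- move=> i; rewrite /u big_seq_cond; apply: big_ind => //; first exact: PD.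
  by move=> x /andP[xs /eqP <-]; exact: Ps.
- exact: seq_finsupp u0.
- rewrite (fsum_seq (undup_uniq _) u0) /u (exchange_big_dep predT) //=.
  rewrite big_seq [RHS]big_seq; apply: eq_bigr => x xs.
  rewrite -big_filter (_ : [seq _ <- _ | _] = [:: x.1]) ?big_seq1 //.
  rewrite (eq_filter (a2 := pred1 x.1)) ?filter_pred1_uniq ?undup_uniq //; last first.
    by move=> i; rewrite /= eq_sym.
  by rewrite mem_undup; exact: map_f.
Qed.

End FiniteSums.

Lemma fsum_morph (I : choiceType) (A B : zmodType) (f : A -> B) (u : I -> A) :
    f 0 = 0 -> (forall a b, f (a + b) = f a + f b) -> finsupp u ->
  f (\sum_(i \in [set: I]) u i) = \sum_(i \in [set: I]) f (u i).
Proof.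
move=> f0 fD /finsupp_seq[r ur u0]; rewrite (fsum_seq ur u0) (big_morph f fD f0).
by rewrite -(fsum_seq ur) // => i /u0 ->.
Qed.

Lemma fsum_mem (I : choiceType) (K : fieldType) (V : vectType K)
    (U : {vspace V}) (w : I -> V) :
  (forall i, w i \in U) -> \sum_(i \in [set: I]) w i \in U.
Proof. by move=> wU; apply: rpred_sum. Qed.

(** * Opposed filtrations *)

Section Purity.
Variables (K : fieldType) (V : mhs K).
Local Notation W := (@weight K V).
Local Notation F' := (@hodge1 K V).
Local Notation F'' := (@hodge2 K V).

(* The preimage in W_n of the step p of the filtration induced on gr^W_n. *)
Definition grW_preim (F : int -> {vspace V}) (n p : int) : {vspace V} :=
  (W n :&: F p + W (n - 1))%VS.

Lemma cls0P (U : {vspace V}) v : (cls U v == 0) = (v \in U).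
Proof. by rewrite -(linear0 (cls U)) cls_eq subr0. Qed.

Lemma mem_grW_fil F n p x : x \in grW_fil W F n p <->
  exists v, [/\ v \in W n, v \in F p & x = cls (W (n - 1)) v].
Proof.
split=> [/memv_imgP[v]|[v [vW vF ->]]].
  by rewrite memv_cap => /andP[vW vF] ->; exists v.
by apply: memv_img; rewrite memv_cap vW.
Qed.

Lemma cls_grW_fil F n p v :
  (cls (W (n - 1)) v \in grW_fil W F n p) = (v \in grW_preim F n p).
Proof.
apply/idP/idP => [/mem_grW_fil[a [aW aF /eqP]]|/memv_addP[a + [b bW ->]]].
  rewrite cls_eq => vaW; rewrite -(subrK a v) addrC.
  by apply: memv_add => //; rewrite memv_cap aW.
rewrite memv_cap => /andP[aW aF]; apply/mem_grW_fil; exists a; split=> //.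
by apply/eqP; rewrite cls_eq addrAC subrr add0r.
Qed.

Lemma weight_le m n : m <= n -> (W m <= W n)%VS.
Proof.
move=> mn; have -> : n = m + `|n - m|%N%:Z by lia.
elim: `|_|%N => [|k IHk]; first by rewrite addr0.
apply: subv_trans IHk _; rewrite -[k.+1]addn1 PoszD addrA.
exact: weight_incr.
Qed.

Lemma decr_le (F : int -> {vspace V}) : (forall p, (F (p + 1)%R <= F p)%VS) ->
  forall p q, p <= q -> (F q <= F p)%VS.
Proof.
move=> Fd p q pq; have -> : q = p + `|q - p|%N%:Z by lia.
elim: `|_|%N => [|k IHk]; first by rewrite addr0.
apply: subv_trans IHk; rewrite -[k.+1]addn1 PoszD addrA.
exact: Fd.
Qed.

Lemma weight_bound : exists N : nat,
  (forall n, n <= - N%:Z -> W n = 0%VS) /\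
  (forall n, N%:Z <= n -> W n = fullv).
Proof.
have [N [W0 Wf]] := weight_finite V; exists N; split=> n nN.
  by apply/eqP; rewrite -subv0 -W0; exact: weight_le.
by apply/eqP; rewrite eqEsubv subvf -Wf; exact: weight_le.
Qed.

Definition finite_decr (F : int -> {vspace V}) : Prop :=
  (forall p q, p <= q -> (F q <= F p)%VS) /\
  exists N : nat, (forall p, p <= - N%:Z -> F p = fullv) /\
                  (forall p, N%:Z <= p -> F p = 0%VS).

Lemma finite_decrP (F : int -> {vspace V}) : (forall p, (F (p + 1)%R <= F p)%VS) ->
  (exists N : nat, F (- N%:Z) = fullv /\ F N%:Z = 0%VS) -> finite_decr F.
Proof.
move=> /decr_le Fd [N [Ff F0]]; split=> //; exists N; split=> p pN.
  by apply/eqP; rewrite eqEsubv subvf -Ff; exact: Fd.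
by apply/eqP; rewrite -subv0 -F0; exact: Fd.
Qed.

Lemma hodge1_finite_decr : finite_decr F'.
Proof. exact: finite_decrP (@hodge1_decr _ V) (hodge1_finite V). Qed.

Lemma hodge2_finite_decr : finite_decr F''.
Proof. exact: finite_decrP (@hodge2_decr _ V) (hodge2_finite V). Qed.

Lemma grW_preim_decr F n p q : finite_decr F -> p <= q ->
  (grW_preim F n q <= grW_preim F n p)%VS.
Proof. by move=> [Fd _] pq; apply: addvS => //; apply: capvS => //; exact: Fd. Qed.

(** The vanishing of the triple graded piece, pulled back to W_n: modulo step q + 1 of F'', a class
    in both steps equals some b in step p + 1 of F' and step q of F''. *)
Lemma pure_step n p q : n != p + q ->
  (grW_preim F' n p :&: grW_preim F'' n q <=
   grW_preim F' n (p + 1) :&: grW_preim F'' n q +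
   grW_preim F' n p :&: grW_preim F'' n (q + 1))%VS.
Proof.
move=> npq; have gr0 := @mhs_pure _ V _ _ _ npq.
apply/subvP => v; rewrite memv_cap => /andP[vX vY].
set U := grW_fil W F'' n (q + 1).
have a2 : cls U (cls (W (n - 1)) v) \in gr2_fil W F' F'' n q p.
  by apply: memv_img; rewrite memv_cap !cls_grW_fil vX vY.
have : cls (gr2_fil W F' F'' n q (p + 1)) (cls U (cls (W (n - 1)) v))
    \in gr3 W F' F'' p q n.
  by apply: memv_img; rewrite memv_cap a2 memvf.
rewrite gr0 memv0 cls0P => /memv_imgP[b].
rewrite memv_cap => /andP[bY bX] /eqP; rewrite cls_eq.
have /mem_grW_fil[b' [_ _ bE]] := bY.
rewrite bE -linearB /= cls_grW_fil => vb.
have b'Y : b' \in grW_preim F'' n q by rewrite -cls_grW_fil -bE.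
have b'X : b' \in grW_preim F' n (p + 1) by rewrite -cls_grW_fil -bE.
rewrite -(subrK b' v) addrC; apply: memv_add; rewrite memv_cap ?b'X ?b'Y //=.
rewrite vb andbT memvB // -cls_grW_fil.
move: b'X; rewrite -cls_grW_fil; apply: subvP; apply: limgS; apply: capvS => //.
exact: hodge1_decr.
Qed.

(** All pairs with p + q > n are subject to [pure_step], which pushes the intersection towards
    larger p + q until one of the filtrations is zero and only W_(n-1) remains. *)
Lemma hodge_cap n p q : p + q = n + 1 ->
  (grW_preim F' n p :&: grW_preim F'' n q <= W (n - 1))%VS.
Proof.
have [F'd [N1 [_ F'0]]] := hodge1_finite_decr.
have [F''d [N2 [_ F''0]]] := hodge2_finite_decr.
have gen k : forall p q, n < p + q -> (N1 + N2)%:Z - p - q <= k%:Z ->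
    (grW_preim F' n p :&: grW_preim F'' n q <= W (n - 1))%VS.
  elim: k => [|k IHk] {}p {}q npq kpq.
    have [pN|pN] := leP N1%:Z p.
      by apply: subv_trans (capvSl _ _) _; rewrite /grW_preim F'0 // capv0 add0v.
    apply: subv_trans (capvSr _ _) _; rewrite /grW_preim F''0 ?capv0 ?add0v //.
    by lia.
  apply: subv_trans (pure_step _) _; first by lia.
  by rewrite subv_add !IHk //; lia.
move=> npq; by apply: (gen (absz ((N1 + N2)%:Z - p - q)%R)); lia.
Qed.

(** Start from steps where both filtrations are everything and raise the indices by [pure_step],
    allowed as long as p0 + q0 < n. Once p0 + q0 = n, either p <= p0 or q <= q0. *)
Lemma hodge_sum n p q : p + q = n + 1 ->
  (W n <= W n :&: F' p + W n :&: F'' q + W (n - 1))%VS.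
Proof.
move=> npq.
have [F'd [N1 [F'f _]]] := hodge1_finite_decr.
have [F''d [N2 [F''f _]]] := hodge2_finite_decr.
suff gen k p0 q0 : p0 + q0 + k%:Z = n ->
    (grW_preim F' n p0 :&: grW_preim F'' n q0 <=
     W n :&: F' p + W n :&: F'' q + W (n - 1))%VS.
  (* At -M both filtrations are exhausted, and the term |n| makes the number n + 2M of steps
     nonnegative. *)
  pose M := (N1 + N2 + `|n|)%N%:Z.
  apply: subv_trans (gen (absz (n + M + M)%R) (- M) (- M) _); last by rewrite /M; lia.
  rewrite /grW_preim F'f ?F''f ?capvf ?subv_cap ?addvSl // /M; lia.
elim: k p0 q0 => [|k IHk] p0 q0 pqn.
  have [pp0|p0p] := leP p p0.
    apply: subv_trans (capvSl _ _) _; rewrite -addvA (addvC (W n :&: F'' q)%VS).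
    rewrite addvA; apply: subv_trans (addvSl _ _).
    exact: grW_preim_decr hodge1_finite_decr pp0.
  apply: subv_trans (capvSr _ _) _; rewrite -addvA; apply: subv_trans (addvSr _ _).
  by apply: grW_preim_decr hodge2_finite_decr _; lia.
apply: subv_trans (pure_step _) _; first by lia.
by rewrite subv_add !IHk //; lia.
Qed.

End Purity.

(** * Deligne's splittings *)

Section DeligneSplitting.
Variables (K : fieldType) (V : mhs K) (A B : int -> {vspace V}).
Local Notation W := (@weight K V).
Hypothesis A_decr : finite_decr A.
Hypothesis opposed_sum : forall n p q, p + q = n + 1 ->
  (W n <= W n :&: A p + W n :&: B q + W (n - 1))%VS.

Lemma opposed_sumP n p q v : p + q = n + 1 -> v \in W n ->
  exists a b, [/\ a \in W n, a \in A p, b \in W n, b \in B q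
    & v - a - b \in W (n - 1)].
Proof.
move=> pq /(subvP (opposed_sum pq))/memv_addP[c + [d dW ->]].
move=> /memv_addP[a + [b + ->]]; rewrite !memv_cap => /andP[aW aA] /andP[bW bB].
by exists a, b; split=> //; rewrite -addrA -opprD addrC addKr.
Qed.

(** In weight n - i the indices p and q - i + 1 add up to n - i + 1, so A^p and B^(q-i+1) span the
    graded piece; this explains Deligne's exponent. Splitting off both parts leaves a remainder of
    lower weight, and the process stops when the weight filtration is zero. *)
Lemma deligne_tail k n p q r : (0 < k)%N -> p + q = n -> r \in W (n - k%:Z) ->
  exists a N, [/\ a \in W (n - k%:Z), a \in A p &
    r - a \in (\sum_(k <= i < N) (W (n - i%:Z)%R :&: B (q - i%:Z + 1)%R))%VS].
Proof.
have [M [W0 _]] := weight_bound V; move=> + pq.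
have [l] : exists l : nat, n - k%:Z <= l%:Z - M%:Z.
  by exists (absz (n - k%:Z + M%:Z)%R); lia.
elim: l k r => [|l IHl] k r nk k_gt0 rW.
  exists 0, k; rewrite !mem0v big_geq // subr0 -(W0 (n - k%:Z)) //.
  by lia.
have [||a [b [aW aA bW bB]]] := @opposed_sumP (n - k%:Z) p (q - k%:Z + 1) r.
- by rewrite addrA addrA pq.
- exact: rW.
rewrite (_ : n - k%:Z - 1 = n - k.+1%:Z); last by lia.
move=> /IHl[||a' [N [a'W a'A rab]]]; [by lia | by [] |].
exists (a + a'), (maxn N k.+1); split; last first.
- rewrite big_ltn ?leq_maxr //.
  have -> : r - (a + a') = b + (r - a - b - a').
    by rewrite opprD addrA [in RHS]addrA [b + _]addrC subrK.
  apply: memv_add; first by rewrite memv_cap bW.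
  have [kN|Nk] := leqP k.+1 N; first exact: rab.
  by move: rab; rewrite big_geq 1?ltnW // memv0 => /eqP ->; rewrite mem0v.
- exact: memvD.
- apply: memvD => //; apply: subvP a'W; apply: weight_le; lia.
Qed.

(** Apply [deligne_tail] with k = 1 to a - b. The term i = 1 of the tail lies in B^q and is absorbed
    by W_n :&: B^q, which is why the sum in Deligne's formula starts at 2. *)
Lemma deligne_lift p q a b :
    a \in W (p + q) -> a \in A p -> b \in W (p + q) -> b \in B q ->
    a - b \in W (p + q - 1) ->
  exists2 c, deligne_piece A B p q c & c \in A p /\ a - c \in W (p + q - 1).
Proof.
move=> aW aA bW bB /(@deligne_tail 1 (p + q) p q _ isT erefl).
move=> [c [N [cW cA abc]]].
have cW' : c \in W (p + q) by apply: subvP cW; apply: weight_le; lia.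
exists (a - c); last by split; [exact: memvB | rewrite opprB addrC subrK].
split; first by rewrite memv_cap !memvB.
exists (maxn N 2).
have : a - b - c \in (W (p + q - 1)%R :&: B q +
    \sum_(2 <= i < maxn N 2) (W (p + q - i%:Z)%R :&: B (q - i%:Z + 1)%R))%VS.
  have [N2|] := leqP 2 N.
    by move: abc; rewrite (big_ltn (m := 1)) // subrK.
  by case: N abc => [|[|//]]; rewrite (big_geq (m := 1)) // memv0 => /eqP -> _;
    rewrite mem0v.
move=> /memv_addP[d + [t tS abcE]]; rewrite memv_cap => /andP[dW dB].
have -> : a - c = b + d + t by rewrite -addrA -abcE addrA [b + _]addrC subrK.
apply: memv_add => //; rewrite memv_cap !memvD //.
by apply: subvP dW; apply: weight_le; lia.
Qed.

Lemma deligne_piece_sub p q v : deligne_piece A B p q v ->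
  v \in W (p + q) /\ v \in A p.
Proof. by move=> [+ _]; rewrite memv_cap => /andP[]. Qed.

Lemma deligne_piece0 p q : deligne_piece A B p q 0.
Proof. by split; [|exists 0%N]; exact: mem0v. Qed.

Lemma sum_widen (U : nat -> {vspace V}) m N N' : (N <= N')%N ->
  (\sum_(m <= i < N) U i <= \sum_(m <= i < N') U i)%VS.
Proof.
move=> NN'; have [Nm|mN] := leqP N m; first by rewrite big_geq // sub0v.
by rewrite (big_cat_nat (ltnW mN) NN') /= addvSl.
Qed.

Lemma deligne_pieceD p q v w : deligne_piece A B p q v ->
  deligne_piece A B p q w -> deligne_piece A B p q (v + w).
Proof.
move=> [vWA [N vB]] [wWA [N' wB]]; split; first exact: memvD.
exists (maxn N N'); apply: memvD.
  by apply: subvP vB; apply: addvS => //; apply: sum_widen; exact: leq_maxl.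
by apply: subvP wB; apply: addvS => //; apply: sum_widen; exact: leq_maxr.
Qed.

Lemma mem_sum_nat (U : nat -> {vspace V}) m N v :
    v \in (\sum_(m <= i < N) U i)%VS ->
  exists2 u, forall i, (m <= i)%N -> u i \in U i & v = \sum_(m <= i < N) u i.
Proof.
elim: N v => [|N IHN] v.
  rewrite big_geq // memv0 => /eqP ->; exists (fun=> 0); rewrite ?big_geq //.
  by move=> i _; exact: mem0v.
have [Nm|mN] := ltnP N m.
  rewrite big_geq // memv0 => /eqP ->; exists (fun=> 0); rewrite ?big_geq //.
  by move=> i _; exact: mem0v.
rewrite big_nat_recr //= => /memv_addP[_ /IHN[u uU ->] [a aU ->]].
exists (fun i => if i == N then a else u i).
  by move=> i mi; case: eqP => [->|_] //; exact: uU.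
rewrite big_nat_recr //= eqxx; congr (_ + _); apply: eq_big_nat => i /andP[_ iN].
by rewrite ltn_eqF.
Qed.

Lemma deligne_piece_tail p q v : deligne_piece A B p q v ->
  exists (N : nat) (u : nat -> V),
  [/\ u 0 \in W (p + q), u 0 \in B q,
      forall i, (0 < i)%N -> u i \in W (p + q - i%:Z) /\ u i \in B (q - i%:Z + 1) &
      v = \sum_(i < N.+1) u i].
Proof.
move=> [_ [N /memv_addP[b + [t /mem_sum_nat[u uS ->] ->]]]].
rewrite memv_cap => /andP[bW bB].
(* The index 1, missing from Deligne's formula, is filled with 0, so that the weight drop can serve
   as the summation index. *)
pose w i := if i == 0 then b else if i == 1 then 0 else
  if (i < N)%N then u i else 0.
exists (maxn N 2).-1, w; rewrite prednK ?leq_max ?orbT //; split=> //.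
- move=> [|[|i]] // _; rewrite /w /=; first by rewrite !mem0v.
  case: ltnP => [iN|_]; last by rewrite !mem0v.
  by have := uS i.+2 isT; rewrite memv_cap => /andP[].
- rewrite -(big_mkord xpredT w) big_ltn ?leq_max ?orbT //.
  rewrite big_ltn ?leq_max ?orbT //= add0r; congr (_ + _).
  have [N2|] := leqP 2 N; last first.
    by move=> N2; rewrite !big_geq // ltnW.
  apply: eq_big_nat => i /andP[i2 iN]; rewrite /w iN.
  by case: i i2 {iN} => [|[|]].
Qed.

Definition deligne_sum (v : V) : Prop :=
  exists2 s : seq (int * int * V),
    forall x, x \in s -> deligne_piece A B x.1.1 x.1.2 x.2
    & v = \sum_(x <- s) x.2.

Lemma deligne_sumD v w : deligne_sum v -> deligne_sum w -> deligne_sum (v + w).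
Proof.
move=> [s sP ->] [t tP ->]; exists (s ++ t); last by rewrite big_cat.
by move=> x; rewrite mem_cat => /orP[/sP|/tP].
Qed.

(** Induction on the weight, and inside one weight downwards along A. For w in A^p, opposedness at
    (p + 1, n - p) gives w = y + z modulo lower weight; then w - y lies in A^p and is congruent to z
    in B^(n-p), so [deligne_lift] replaces it by a piece, and y lies in A^(p+1). *)
Lemma deligne_sum_total v : deligne_sum v.
Proof.
have [M [W0 Wf]] := weight_bound V; have [Ad [N [Af A0]]] := A_decr.

have sum0 : deligne_sum 0 by exists [::]; rewrite ?big_nil.
suff gen l n u : n <= l%:Z - M%:Z -> u \in W n -> deligne_sum u.
  by apply: (gen (M + M)%N M%:Z); [lia | rewrite Wf ?memvf].
elim: l n u => [|l IHl] n u nl uW.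
  by move: uW; rewrite W0 ?memv0 => [/eqP ->|]; last by lia.
have lower w : w \in W (n - 1) -> deligne_sum w by apply: IHl; lia.
suff inner k p w : N%:Z - p <= k%:Z -> w \in W n -> w \in A p -> deligne_sum w.
  by apply: (inner (N + N)%N (- N%:Z)) => //; [lia | rewrite Af ?memvf].
elim: k p w => [|k IHk] p w pk wW wA.
  by move: wA; rewrite A0 ?memv0 => [/eqP ->|]; last by lia.
have [||y [z [yW yA zW zB rW]]] := @opposed_sumP n (p + 1) (n - p) w.
- by lia.
- exact: wW.
have pn : p + (n - p) = n by rewrite addrC subrK.
have [|||||c cP [cA acW]] := @deligne_lift p (n - p) (w - y) z; rewrite ?pn //.
- exact: memvB.
- by apply: memvB => //; apply: subvP yA; apply: Ad; lia.
rewrite -(subrK y w) -(subrK c (w - y)); apply: deligne_sumD; last first.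
  by apply: (IHk (p + 1)) => //; lia.
apply: deligne_sumD; first by apply: lower; rewrite pn in acW.
by exists [:: ((p, n - p), c)]; rewrite ?big_seq1 // => x; rewrite inE => /eqP ->.
Qed.

End DeligneSplitting.

(** * The bigrading of the associated graded *)

Section OpposedGraded.
Variables (K : fieldType) (V : mhs K) (A B : int -> {vspace V}).
Local Notation W := (@weight K V).
Hypotheses (A_decr : finite_decr A) (B_decr : finite_decr B).
Hypothesis opposed_cap : forall n p q, p + q = n + 1 ->
  (grW_preim A n p :&: grW_preim B n q <= W (n - 1))%VS.

Lemma grW_fil_decr n p q : p <= q ->
  (grW_fil W B n q <= grW_fil W B n p)%VS.
Proof. by move=> pq; apply: limgS; apply: capvS => //; exact: (proj1 B_decr). Qed.

Lemma opposed_grW n p q z : p + q = n + 1 ->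
  z \in grW_fil W A n p -> z \in grW_fil W B n q -> z = 0.
Proof.
move=> pq zA; have /mem_grW_fil[v [_ _ zE]] := zA.
move: zA; rewrite zE !cls_grW_fil => vA vB; apply/eqP; rewrite cls0P.
by apply: subvP (opposed_cap pq) _ _; rewrite memv_cap vA.
Qed.

(** Descending induction on p, starting where A vanishes. In w p = x - (the other terms), the terms
    of index above p are already zero, while x and those below p lie in step n - p + 1 of B;
    opposedness with step p of A leaves 0. *)
Lemma grW_component n r (w : int -> V) x : finsupp w ->
    (forall p, w p \in grW_fil W A n p) ->
    (forall p, w p \in grW_fil W B n (n - p)) ->
    x = \sum_(p \in [set: int]) w p -> x \in grW_fil W B n r ->
  forall p, n - p < r -> w p = 0.
Proof.
move=> w_fin wA wB xE xr; have [_ [N [_ A0]]] := A_decr.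
suff gen k p : N%:Z - p <= k%:Z -> n - p < r -> w p = 0.
  by move=> p; apply: (gen (absz (N%:Z - p)%R)); lia.
elim: k p => [|k IHk] p pk pr.
  have := wA p; rewrite /grW_fil /induced A0 ?capv0 ?limg0 ?memv0; last by lia.
  by move/eqP.
apply: (@opposed_grW n p (n - p + 1)) => //; first by lia.
pose w' j := if j == p then 0 else w j.
have w'_fin : finsupp w'.
  apply: sub_finite_set w_fin => j /=; rewrite /w'; case: ifP => //.
  by rewrite eqxx.
have -> : w p = x - \sum_(j \in [set: int]) w' j.
  apply/eqP; rewrite eq_sym subr_eq xE -{1}(fsum_delta p (w p)) -fsumD //; last first.
    by apply: (@seq_finsupp _ _ _ [:: p]) => j; rewrite inE => /negPf ->.
  apply/eqP/eq_fsbigr => j _; rewrite /w'.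
  by case: eqP => [->|_]; rewrite ?addr0 ?add0r.
apply: memvB; first by apply: subvP xr; apply: grW_fil_decr; lia.
apply: fsum_mem => j; rewrite /w'; case: eqP => [_|jp]; first exact: mem0v.
have [pj|jp'] := ltP p j; last first.
  by apply: subvP (wB j); apply: grW_fil_decr; lia.
by rewrite IHk ?mem0v //; lia.
Qed.

End OpposedGraded.

Section HodgeGraded.
Variables (K : fieldType) (V : mhs K).
Local Notation W := (@weight K V).
Local Notation F' := (@hodge1 K V).
Local Notation F'' := (@hodge2 K V).

Lemma hodge_capC n p q : p + q = n + 1 ->
  (grW_preim F'' n p :&: grW_preim F' n q <= W (n - 1))%VS.
Proof. by move=> pq; rewrite capvC; apply: hodge_cap; rewrite addrC. Qed.

Lemma hodge_sumC n p q : p + q = n + 1 ->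
  (W n <= W n :&: F'' p + W n :&: F' q + W (n - 1))%VS.
Proof.
by move=> pq; rewrite (addvC (_ :&: F'' p)%VS); apply: hodge_sum; rewrite addrC.
Qed.

Lemma grpqP p q w : w \in grpq V (p, q) <->
  w \in grW_fil W F' (p + q) p /\ w \in grW_fil W F'' (p + q) q.
Proof. by rewrite memv_cap; split=> [/andP|[-> ->]]. Qed.

Lemma grpq_finite : exists r : seq (int * int), uniq r /\
  forall pq, pq \notin r -> grpq V pq = 0%VS.
Proof.
have [M [W0 _]] := weight_bound V.
have [_ [N1 [_ F'0]]] := @hodge1_finite_decr _ V.
have [_ [N2 [_ F''0]]] := @hodge2_finite_decr _ V.
pose b := (M + N1 + N2)%N.
pose l := [seq i%:Z - b%:Z | i <- iota 0 (b + b)].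
exists (undup [seq (i, j) | i <- l, j <- l]); split; first exact: undup_uniq.
have lP i : - b%:Z <= i -> i < b%:Z -> i \in l.
  move=> ib1 ib2; apply/mapP; exists (absz (i + b%:Z)%R); last by lia.
  by rewrite mem_iota; lia.
move=> [p q]; rewrite mem_undup => pql; apply/eqP; rewrite -subv0.
have [pN|pN] := leP N1%:Z p.
  apply: subv_trans (capvSl _ _) _.
  by rewrite /grW_fil /induced F'0 ?capv0 ?limg0.
have [qN|qN] := leP N2%:Z q.
  apply: subv_trans (capvSr _ _) _.
  by rewrite /grW_fil /induced F''0 ?capv0 ?limg0.
have [pqM|pqM] := leP (p + q) (- M%:Z).
  apply: subv_trans (capvSl _ _) _.
  by rewrite /grW_fil /induced (W0 (p + q)) // cap0v limg0.
case/negP: pql; apply/allpairsP; exists (p, q); split=> //; apply: lP;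
  rewrite /b /=; lia.
Qed.

Lemma grpq_diag_finsupp n (w : int -> V) :
  (forall p, w p \in grpq V (p, n - p)) -> finsupp w.
Proof.
move=> wP; have [r [_ r0]] := grpq_finite.
apply: (@seq_finsupp _ _ _ (map fst r)) => p pr; apply/eqP.
rewrite -memv0 -(r0 (p, n - p)) //.
by apply: contra pr => pr; apply/mapP; exists (p, n - p).
Qed.

Lemma grpq_component2 n r (w : int -> V) x :
    (forall p, w p \in grpq V (p, n - p)) ->
    x = \sum_(p \in [set: int]) w p -> x \in grW_fil W F'' n r ->
  forall p, n - p < r -> w p = 0.
Proof.
move=> wP; have w_fin := grpq_diag_finsupp wP.
have wP' p : w p \in grW_fil W F' n p /\ w p \in grW_fil W F'' n (n - p).
  by have /grpqP := wP p; rewrite addrC subrK.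
apply: (grW_component (@hodge1_finite_decr _ V) (@hodge2_finite_decr _ V)
  (@hodge_cap _ V) w_fin) => p; by case: (wP' p).
Qed.

(** The same argument with the two filtrations exchanged, hence with the family reindexed by q = n -
    p. *)
Lemma grpq_component1 n r (w : int -> V) x :
    (forall p, w p \in grpq V (p, n - p)) ->
    x = \sum_(p \in [set: int]) w p -> x \in grW_fil W F' n r ->
  forall p, p < r -> w p = 0.
Proof.
move=> wP xE xr p pr; have w_fin := grpq_diag_finsupp wP.
have wP' q : w q \in grW_fil W F' n q /\ w q \in grW_fil W F'' n (n - q).
  by have /grpqP := wP q; rewrite addrC subrK.
have := @grW_component _ V F'' F' (@hodge2_finite_decr _ V)
  (@hodge1_finite_decr _ V) (@hodge_capC) n r (fun q => w (n - q)) x.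
move=> /(_ _ _ _ _ xr (n - p)); rewrite subKr; apply=> //.
- have [s _ s0] := finsupp_seq w_fin.
  apply: (@seq_finsupp _ _ _ [seq n - q | q <- s]) => q qs; apply: s0.
  by apply: contra qs => qs; apply/mapP; exists (n - q); rewrite ?subKr.
- by move=> q; have [_] := wP' (n - q); rewrite subKr.
- by move=> q; have [] := wP' (n - q).
- rewrite xE; apply: (reindex_fsbigT (fun q : int => n - q) w).
  by exists (fun q => n - q) => q; rewrite subKr.
Qed.

Lemma grpq_direct n (w w' : int -> V) :
    (forall p, w p \in grpq V (p, n - p)) ->
    (forall p, w' p \in grpq V (p, n - p)) ->
    \sum_(p \in [set: int]) w p = \sum_(p \in [set: int]) w' p ->
  forall p, w p = w' p.
Proof.
move=> wP w'P ww' p; apply/eqP; rewrite -subr_eq0; apply/eqP.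
have w_fin := grpq_diag_finsupp wP.
have Nw'P q : - w' q \in grpq V (q, n - q) by rewrite memvN.
have Nw'_fin := grpq_diag_finsupp Nw'P.
apply: (@grpq_component2 n (n - p + 1) (fun p => w p - w' p) 0).
- by move=> q; apply: memvB.
- rewrite fsumD // ww' -fsumD //; last exact: grpq_diag_finsupp w'P.
  by rewrite fsbig1 // => q _; rewrite subrr.
- exact: mem0v.
- by lia.
Qed.

Lemma grpq_lift1 p q w : w \in grpq V (p, q) ->
  exists2 u, split1 (p, q) u & w = cls (W (p + q - 1)) u.
Proof.
move=> /grpqP[/mem_grW_fil[a [aW aF ->]] /mem_grW_fil[b [bW bF /eqP]]].
rewrite cls_eq => ab.
have [c cP [_ ac]] := deligne_lift (@hodge_sum _ V) aW aF bW bF ab.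
by exists c => //; apply/eqP; rewrite cls_eq.
Qed.

Lemma split1_exists (w : int * int -> V) : gr_bigraded w ->
  exists v u, is_decomposition (@split1 K V) v u /\ w = to_gr u.
Proof.
(* Zero classes are required to lift to zero; otherwise the chosen lifts need not have finite
   support. *)
move=> wP; have lifts pq : exists u, split1 pq u /\ w pq = cls (W (pq.1 + pq.2 - 1)) u
    /\ (w pq = 0 -> u = 0).
  have [w0|w0] := eqVneq (w pq) 0.
    by exists 0; rewrite w0 linear0; split=> //; exact: deligne_piece0.
  have := wP pq; case: pq w0 => p q w0 /grpq_lift1[u uP wE]; exists u.
  by split=> //; split=> // w0'; rewrite w0' eqxx in w0.
have [u uP] := choice lifts; exists (\sum_(pq \in [set: int * int]) u pq), u.
split; last by apply/funext => pq; have [_ []] := uP pq.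
have [r [_ r0]] := grpq_finite.
split=> //; first by move=> pq; have [] := uP pq.
apply: (@seq_finsupp _ _ _ r) => pq /r0 pq0.
have [_ [_]] := uP pq; apply; apply/eqP; rewrite -memv0 -pq0; exact: wP.
Qed.

Lemma split2_exists (v : V) : exists u, is_decomposition (@split2 K V) v u.
Proof.
have [s sP ->] := deligne_sum_total (@hodge2_finite_decr _ V) (@hodge_sumC) v.
pose t := [seq ((x.1.2, x.1.1), x.2) | x <- s].
exists (fun i => \sum_(x <- t | x.1 == i) x.2).
rewrite (_ : \sum_(x <- s) x.2 = \sum_(x <- t) x.2); last by rewrite big_map.
apply: decomposition_of_seq.
- by move=> i; exact: deligne_piece0.
- by move=> i a b; exact: deligne_pieceD.
- by move=> _ /mapP[x /sP xP ->].
Qed.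

End HodgeGraded.

(** * Flat sections along a line *)

Section FlatExpansion.
Variables (K : fieldType) (M : lmodType {poly {poly K}}).
Variables (D : M -> M) (t : {poly {poly K}}).
Hypothesis K_char0 : forall n, n.+1%:R != 0 :> K.
Hypotheses (D_add : forall m m', D (m + m') = D m + D m')
  (D_cst : forall (c : K) (m : M), D (cst c *: m) = cst c *: D m)
  (D_t : forall m : M, D (t *: m) = m + t *: D m).

Lemma fact_neq0 n : n`!%:R != 0 :> K.
Proof. by rewrite -(prednK (fact_gt0 n)) K_char0. Qed.

Lemma flow_0 : D 0 = 0.
Proof. by apply: (addrI (D 0)); rewrite -D_add !addr0. Qed.

Lemma flow_iter_add n m m' : iter n D (m + m') = iter n D m + iter n D m'.
Proof. by elim: n => //= n ->; rewrite D_add. Qed.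

Lemma flow_iter0 n : iter n D 0 = 0.
Proof. by elim: n => //= n ->; exact: flow_0. Qed.

Lemma flow_iter_sum (I : Type) (r : seq I) (P : pred I) (F : I -> M) n :
  iter n D (\sum_(i <- r | P i) F i) = \sum_(i <- r | P i) iter n D (F i).
Proof. exact: (big_morph _ (flow_iter_add n) (flow_iter0 n)). Qed.

Lemma flow_iter_cst n (c : K) m : iter n D (cst c *: m) = cst c *: iter n D m.
Proof. by elim: n => //= n ->; rewrite D_cst. Qed.

Lemma flow_natmul n m : D (m *+ n) = D m *+ n.
Proof. by elim: n => [|n IHn]; rewrite ?mulr0n ?flow_0 // !mulrS D_add IHn. Qed.

Lemma flow_iter_natmul k n m : iter k D (m *+ n) = iter k D m *+ n.
Proof. by elim: k => //= k ->; exact: flow_natmul. Qed.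

Lemma flow_exp n c : D c = 0 -> D (t ^+ n.+1 *: c) = t ^+ n *: c *+ n.+1.
Proof.
move=> Dc; elim: n => [|n IHn].
  by rewrite expr1 D_t Dc scaler0 addr0 expr0 scale1r.
rewrite exprS -scalerA D_t IHn [in RHS]mulrS; congr (_ + _).
by rewrite -scalerMnr scalerA exprS.
Qed.

Lemma flow_iter_exp n c : D c = 0 -> iter n D (t ^+ n *: c) = c *+ n`!.
Proof.
move=> Dc; elim: n => [|n IHn]; first by rewrite expr0 scale1r.
rewrite iterSr flow_exp // factS mulnC mulrnA -IHn.
exact: flow_iter_natmul.
Qed.

Lemma flow_iter_exp0 n k c : D c = 0 -> (n < k)%N -> iter k D (t ^+ n *: c) = 0.
Proof.
move=> Dc nk; rewrite -(subnK nk) iterD /= flow_iter_exp // flow_natmul Dc.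
by rewrite mul0rn flow_iter0.
Qed.

(* M is the space of polynomials in t over the kernel of D. *)
Lemma flat_expansion (P : M -> Prop) :
    (forall m m', P m -> P m' -> P (m + m')) ->
    (forall (c : K) m, P m -> P (cst c *: m)) ->
    (forall m, P m -> P (t *: m)) -> (forall m, P m -> P (D m)) ->
  forall N m, iter N D m = 0 -> P m ->
  exists2 c : nat -> M, forall n, D (c n) = 0 /\ P (c n)
    & m = \sum_(n < N) t ^+ n *: c n.
Proof.
move=> PD Pc Pt Pflow; elim=> [|N IHN] m DNm Pm.
  exists (fun=> 0); last by rewrite big_ord0 -DNm.
  by move=> _; split; [exact: flow_0 | move: Pm => /(Pc 0); rewrite scale0r].
(* Taylor's formula: this is the coefficient of t^N. It is flat, and subtracting t^N a makes m
   killed by D^N. *)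
pose a := cst (N`!%:R^-1 : K) *: iter N D m.
have Da : D a = 0 by rewrite D_cst -iterS DNm scaler0.
have Pa : P a by apply: Pc; elim: N {IHN DNm a Da} => //= n; exact: Pflow.
have aE : a *+ N`! = iter N D m.
  by rewrite -scaler_nat scalerA /cst -!polyC_natr -!polyCM mulfV ?scale1r ?fact_neq0.
have [||c cP mE] := IHN (m + cst (-1 : K) *: (t ^+ N *: a)).
- rewrite flow_iter_add flow_iter_cst flow_iter_exp // aE.
  by rewrite /cst !polyCN scaleN1r subrr.
- apply: PD => //; apply: Pc.
  by elim: (N) => [|n]; rewrite ?scale1r // exprS -scalerA; exact: Pt.
exists (fun n => if n == N then a else c n).
  by move=> n; case: eqP => [_|_] //; split.
rewrite big_ord_recr /= eqxx.
rewrite (eq_bigr (fun n : 'I_N => t ^+ n *: c n)) => [|i _]; last first.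
  by rewrite ltn_eqF.
by rewrite -mE /cst !polyCN scaleN1r subrK.
Qed.

(** The operator D^n kills the lower powers of t and turns the top term t^n c_n into n! c_n. *)
Lemma flat_expansion_eq0 N (c : nat -> M) : (forall n, D (c n) = 0) ->
  \sum_(n < N) t ^+ n *: c n = 0 -> forall n, (n < N)%N -> c n = 0.
Proof.
move=> Dc; elim: N => [|N IHN] // /[dup] sum0.
move=> /(congr1 (iter N D)); rewrite flow_iter0 big_ord_recr /= flow_iter_add.
rewrite flow_iter_exp // flow_iter_sum big1 => [|i _]; last exact: flow_iter_exp0.
rewrite add0r => /(congr1 (fun m => cst (N`!%:R^-1 : K) *: m)).
rewrite scaler0 -scaler_nat scalerA /cst -!polyC_natr -!polyCM mulVf ?fact_neq0 // scale1r.
move=> cN0 n; rewrite ltnS leq_eqVlt => /orP[/eqP -> //|].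
by apply: IHN; move: sum0; rewrite big_ord_recr /= cN0 scaler0 addr0.
Qed.

Hypothesis D_nil : forall m, exists N, iter N D m = 0.

Lemma flow_nil2 m m' : exists N, iter N D m = 0 /\ iter N D m' = 0.
Proof.
have [N mN] := D_nil m; have [N' mN'] := D_nil m'; exists (N + N')%N.
by split; [rewrite addnC iterD mN | rewrite iterD mN']; exact: flow_iter0.
Qed.

(** For r an equation of a line and t a coordinate on it vanishing at a point: a flat section
    vanishing at the point vanishes on the line. Expanding m1 and m2 in powers of t and comparing
    constant terms shows that m is r times the constant term of m2. *)
Lemma flat_point_vanish r m m1 m2 : (forall m : M, D (r *: m) = r *: D m) ->
  D m = 0 -> m = t *: m1 + r *: m2 -> exists m', m = r *: m'.
Proof.
(* The successor guarantees 0 < N, so that the expansion of m2 does have a constant term. *)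
move=> D_r Dm mE; have [N0 [m1N0 m2N0]] := flow_nil2 m1 m2; pose N := N0.+1.
have m1N : iter N D m1 = 0 by rewrite iterS m1N0 flow_0.
have m2N : iter N D m2 = 0 by rewrite iterS m2N0 flow_0.
have expT := @flat_expansion (fun=> True) _ _ _ _ N.
have [//|//|//|//||//|c1 c1P m1E] := expT _ _ _ _ m1; first exact: m1N.
have [//|//|//|//||//|c2 c2P m2E] := expT _ _ _ _ m2; first exact: m2N.
exists (c2 0%N); apply/esym/eqP; rewrite -subr_eq0; apply/eqP.
pose g n := if (n < N)%N then r *: c2 n else 0.
pose h n := if n is n'.+1 then c1 n' else cst (-1 : K) *: m.
have hE : r *: c2 0%N - m = g 0%N + h 0%N by rewrite /h /cst !polyCN scaleN1r.
rewrite hE; apply: (@flat_expansion_eq0 N.+1 (fun n => g n + h n) _ _ 0 isT).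
  move=> n; rewrite D_add (_ : D (g n) = 0) ?add0r; last first.
    by rewrite /g; case: ifP => _; rewrite ?flow_0 // D_r (proj1 (c2P _)) scaler0.
  by case: n => [|n] /=; rewrite ?(proj1 (c1P _)) // D_cst Dm scaler0.
under eq_bigr do rewrite scalerDr.
rewrite big_split /= (big_ord_recr N) (big_ord_recl N) /= {2}/g ltnn scaler0 addr0.
rewrite expr0 scale1r (eq_bigr (fun i : 'I_N => r *: (t ^+ i *: c2 i))); last first.
  by move=> i _; rewrite /g ltn_ord !scalerA mulrC.
rewrite -scaler_sumr -m2E.
under eq_bigr do rewrite /bump add1n exprS -scalerA.
rewrite -scaler_sumr -m1E /cst !polyCN scaleN1r addrCA [r *: m2 + _]addrC -mE.
by rewrite addNr.
Qed.

End FlatExpansion.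

(** * Equivariant bundles with connection *)

Lemma seq_lower_bound (T : eqType) (s : seq T) (w : T -> int) :
  exists b, forall x, x \in s -> b <= w x.
Proof.
elim: s => [|x s [b bP]]; first by exists 0.
exists (Order.min (w x) b) => y; rewrite inE ge_min => /orP[/eqP -> //|/bP ->].
  by rewrite lexx.
by rewrite orbT.
Qed.

Section PlaneModules.
Variables (K : fieldType) (M : lmodType {poly {poly K}}).

Lemma scale_closed (Q : M -> Prop) : Q 0 ->
    (forall m m', Q m -> Q m' -> Q (m + m')) ->
    (forall (c : K) m, Q m -> Q (cst c *: m)) ->
    (forall m, Q m -> Q ('X *: m)) -> (forall m, Q m -> Q ('Y *: m)) ->
  forall (f : {poly {poly K}}) m, Q m -> Q (f *: m).
Proof.
move=> Q0 QD Qc QX QY f; elim/poly_ind: f => [|p c IHp] m Qm.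
  by rewrite scale0r.
rewrite scalerDl -scalerA; apply: (QD); first by apply: IHp; exact: QX.
move: m Qm; elim/poly_ind: c => [|q a IHq] m Qm; first by rewrite scale0r.
rewrite polyCD polyCM scalerDl -scalerA; apply: (QD); last exact: Qc.
by apply: IHq; exact: QY.
Qed.

End PlaneModules.

Section Connection.
Variables (K : fieldType) (E : eqbun K).
Implicit Types (m : E) (c : K).

Lemma cst0 : cst 0 = 0 :> {poly {poly K}}. Proof. by rewrite /cst !polyC0. Qed.
Lemma cst1 : cst 1 = 1 :> {poly {poly K}}. Proof. by []. Qed.
Lemma cstD c c' : cst (c + c') = cst c + cst c'. Proof. by rewrite /cst !polyCD. Qed.
Lemma cstM c c' : cst (c * c') = cst c * cst c'. Proof. by rewrite /cst !polyCM. Qed.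
Lemma cstN c : cst (- c) = - cst c. Proof. by rewrite /cst !polyCN. Qed.

Lemma d1_cst c : d1 (cst c) = 0. Proof. exact: derivC. Qed.
Lemma d2_cst c : d2 (cst c) = 0.
Proof. by rewrite /d2 /cst map_polyC /= derivC polyC0. Qed.
Lemma d1_X : d1 'X = 1 :> {poly {poly K}}. Proof. exact: derivX. Qed.
Lemma d2_X : d2 'X = 0 :> {poly {poly K}}.
Proof.
rewrite /d2; apply/polyP => i; rewrite coef_map_id0 ?deriv0 // coefX coef0.
by case: eqP => _; rewrite ?derivC ?deriv0 // -polyC1 derivC.
Qed.
Lemma d1_Y : d1 'Y = 0 :> {poly {poly K}}. Proof. exact: derivC. Qed.
Lemma d2_Y : d2 'Y = 1 :> {poly {poly K}}.
Proof. by rewrite /d2 map_polyC /= derivX. Qed.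

Lemma nabla1_0 : nabla1 (0 : E) = 0.
Proof. by apply: (addrI (nabla1 (0 : E))); rewrite -nabla1D !addr0. Qed.
Lemma nabla2_0 : nabla2 (0 : E) = 0.
Proof. by apply: (addrI (nabla2 (0 : E))); rewrite -nabla2D !addr0. Qed.
Lemma nabla1_cst c m : nabla1 (cst c *: m) = cst c *: nabla1 m.
Proof. by rewrite nabla1Z d1_cst scale0r add0r. Qed.
Lemma nabla2_cst c m : nabla2 (cst c *: m) = cst c *: nabla2 m.
Proof. by rewrite nabla2Z d2_cst scale0r add0r. Qed.
Lemma nabla1N m : nabla1 (- m) = - nabla1 m.
Proof. by apply/eqP; rewrite -addr_eq0 -nabla1D addNr nabla1_0. Qed.
Lemma nabla2N m : nabla2 (- m) = - nabla2 m.
Proof. by apply/eqP; rewrite -addr_eq0 -nabla2D addNr nabla2_0. Qed.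
Lemma nabla1_X m : nabla1 ('X *: m) = m + 'X *: nabla1 m.
Proof. by rewrite nabla1Z d1_X scale1r. Qed.
Lemma nabla2_X m : nabla2 ('X *: m) = 'X *: nabla2 m.
Proof. by rewrite nabla2Z d2_X scale0r add0r. Qed.
Lemma nabla1_Y m : nabla1 ('Y *: m) = 'Y *: nabla1 m.
Proof. by rewrite nabla1Z d1_Y scale0r add0r. Qed.
Lemma nabla2_Y m : nabla2 ('Y *: m) = m + 'Y *: nabla2 m.
Proof. by rewrite nabla2Z d2_Y scale1r. Qed.

Definition weight_ge (b : int) m : Prop :=
  exists2 s : seq (int * int * E),
    forall x, x \in s -> homog x.1 x.2 /\ b <= x.1.1 + x.1.2
    & m = \sum_(x <- s) x.2.

Lemma homogD ab m m' : homog ab m -> homog ab m' -> homog ab (m + m').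
Proof. by move=> h h'; rewrite -[m]scale1r -cst1; exact: homogP. Qed.

Lemma homog_cst ab c m : homog ab m -> homog ab (cst c *: m).
Proof. by move=> h; rewrite -[_ *: m]addr0; apply: homogP => //; exact: homog0. Qed.

Lemma weight_geD b m m' : weight_ge b m -> weight_ge b m' -> weight_ge b (m + m').
Proof.
move=> [s sP ->] [t tP ->]; exists (s ++ t); last by rewrite big_cat.
by move=> x; rewrite mem_cat => /orP[/sP|/tP].
Qed.

Lemma weight_ge_map b m (sh : int * int -> int * int) (h : E -> E) :
    h 0 = 0 -> (forall m m', h (m + m') = h m + h m') ->
    (forall ab m, homog ab m -> homog (sh ab) (h m)) ->
    (forall ab, ab.1 + ab.2 <= (sh ab).1 + (sh ab).2) ->
  weight_ge b m -> weight_ge b (h m).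
Proof.
move=> h0 hD hh hsh [s sP ->]; exists [seq (sh x.1, h x.2) | x <- s].
  move=> _ /mapP[x /sP[xh xb] ->]; split; first exact: hh.
  exact: le_trans (hsh x.1).
by rewrite big_map (big_morph h hD h0).
Qed.

Lemma weight_ge_scale b (f : {poly {poly K}}) m :
  weight_ge b m -> weight_ge b (f *: m).
Proof.
apply: scale_closed.
- by exists [::]; rewrite ?big_nil.
- exact: weight_geD.
- move=> c m'; apply: (@weight_ge_map b m' id); rewrite ?scaler0 //.
    exact: scalerDr.
  by move=> ab m''; exact: homog_cst.
- move=> m'; apply: (@weight_ge_map b m' (fun ab => (ab.1 + 1, ab.2)));
    rewrite ?scaler0 //.
  + exact: scalerDr.
  + by move=> [a c] m''; exact: homog_t1.
  + by move=> ab /=; lia.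
- move=> m'; apply: (@weight_ge_map b m' (fun ab => (ab.1, ab.2 + 1)));
    rewrite ?scaler0 //.
  + exact: scalerDr.
  + by move=> [a c] m''; exact: homog_t2.
  + by move=> ab /=; lia.
Qed.

Lemma homog_decomposition m : exists s : seq (int * int * E),
  (forall x, x \in s -> homog x.1 x.2) /\ m = \sum_(x <- s) x.2.
Proof.
have [u [[uh /finsupp_seq[r ur u0] ->] _]] := homog_unique m.
exists [seq (i, u i) | i <- r]; rewrite big_map (fsum_seq ur u0).
by split=> // _ /mapP[i _ ->].
Qed.

(** Each of the finitely many generators has finitely many homogeneous components, and
    multiplication by t_1, t_2 only raises the total weight. *)
Lemma weight_ge_bounded : exists b, forall m, weight_ge b m.
Proof.
have [r [f [g fgK]]] := eqbun_projective E.
have gen : exists b, forall i : 'I_r, weight_ge b (g (delta_mx 0 i)).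
  have dec (i : 'I_r) : exists b, weight_ge b (g (delta_mx 0 i)).
    have [s [sh ->]] := homog_decomposition (g (delta_mx 0 i)).
    have [b bP] := seq_lower_bound s (fun x => x.1.1 + x.1.2).
    by exists b, s => // x xs; split; [exact: sh | exact: bP].
  have [b' b'P] := choice dec.
  have [b bP] := seq_lower_bound (index_enum 'I_r) b'; exists b => i.
  have [s sP ->] := b'P i; exists s => // x /sP[xh xb]; split=> //.
  by apply: le_trans xb; apply: bP; exact: mem_index_enum.
have [b bP] := gen; exists b => m; rewrite -[m]fgK (row_sum_delta (f m)).
rewrite linear_sum; apply: big_ind => [|m1 m2|i _].
- by exists [::]; rewrite ?big_nil.
- exact: weight_geD.
- by rewrite linearZ; apply: weight_ge_scale.
Qed.

(** By uniqueness, the decomposition of m concentrated in [ab] agrees with the one grouped from a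
    list of weights at least b, in which the index [ab] does not occur. *)
Lemma homog_lt0 b ab m : weight_ge b m -> homog ab m -> ab.1 + ab.2 < b -> m = 0.
Proof.
move=> [s sP mE] mh mb; have [u [uP u_uniq]] := homog_unique m.
have sdec := @decomposition_of_seq _ _ (@homog _ E) s (@homog0 _ E)
  (@homogD) (fun x xs => proj1 (sP x xs)).
rewrite -mE in sdec; have us := u_uniq _ sdec.
have ud : u = fun i => if i == ab then m else 0.
  apply: u_uniq; split.
  - by move=> i; case: eqP => [->|_] //; exact: homog0.
  - by apply: (@seq_finsupp _ _ _ [:: ab]) => i; rewrite inE => /negPf ->.
  - by rewrite fsum_delta.
have -> : m = u ab by rewrite ud eqxx.
rewrite us big_seq_cond big1 // => x /andP[/sP[_ xb] /eqP xab].
by move: mb; rewrite -xab ltNge xb.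
Qed.

(* All words of length n in nabla1 and nabla2 vanish on m. *)
Fixpoint killed (n : nat) m : Prop :=
  if n is n'.+1 then killed n' (nabla1 m) /\ killed n' (nabla2 m) else m = 0.

Lemma killed_0 n : killed n 0.
Proof. by elim: n => //= n IHn; rewrite nabla1_0 nabla2_0. Qed.

Lemma killedD n m m' : killed n m -> killed n m' -> killed n (m + m').
Proof.
elim: n m m' => [|n IHn] m m' /=; first by move=> -> ->; rewrite addr0.
by move=> [? ?] [? ?]; rewrite nabla1D nabla2D; split; exact: IHn.
Qed.

Lemma killed_cst n c m : killed n m -> killed n (cst c *: m).
Proof.
elim: n m => [|n IHn] m /=; first by move=> ->; rewrite scaler0.
by move=> [? ?]; rewrite nabla1_cst nabla2_cst; split; exact: IHn.
Qed.

Lemma killed_le n k m : (n <= k)%N -> killed n m -> killed k m.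
Proof.
elim: n k m => [|n IHn] [|k] m //=; first by move=> _ ->; exact: (killed_0 k.+1).
by move=> nk [? ?]; split; exact: IHn.
Qed.

(* nabla1 and nabla2 lower the weight, and the weights of a finitely generated
   module are bounded below. *)
Lemma connection_nilpotent m : exists n, killed n m.
Proof.
have [b bP] := weight_ge_bounded.
have hom n ab m' : homog ab m' -> ab.1 + ab.2 < b + n%:Z -> killed n m'.
  elim: n ab m' => [|n IHn] [a c] m' mh mb /=.
    by apply: homog_lt0 (bP m') mh _; rewrite addr0 in mb.
  split; [apply: (IHn (a - 1, c)) | apply: (IHn (a, c - 1))] => /=.
  - exact: homog_nabla1.
  - by move: mb => /=; lia.
  - exact: homog_nabla2.
  - by move: mb => /=; lia.
have [s [sh ->]] := homog_decomposition m.
elim: s sh => [|x s IHs] sh; first by exists 0%N; rewrite big_nil.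
have [|n nP] := IHs; first by move=> y ys; apply: sh; rewrite inE ys orbT.
exists (n + (absz (x.1.1 + x.1.2 - b + 1)%R))%N; rewrite big_cons; apply: killedD.
  by apply: (hom _ x.1); [apply: sh; rewrite inE eqxx | lia].
exact: killed_le (leq_addr _ _) nP.
Qed.

Section Fiber.
Variable x : K * K.

Lemma valueD m m' : value x (m + m') = value x m + value x m'.
Proof. exact: raddfD. Qed.

Lemma value0 : value x (0 : E) = 0.
Proof. exact: raddf0. Qed.

Lemma valueN m : value x (- m) = - value x m.
Proof. exact: raddfN. Qed.

Lemma value_sum (I : Type) (r : seq I) (P : pred I) (F : I -> E) :
  value x (\sum_(i <- r | P i) F i) = \sum_(i <- r | P i) value x (F i).
Proof. exact: (big_morph _ valueD value0). Qed.

Lemma value_surj (e : fiber E x) : exists m, value x m = e.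
Proof. by exists (repr e); rewrite /value reprK. Qed.

Lemma value_eq0 m : value x m = 0 <->
  exists m1 m2, m = ('X - cst x.1) *: m1 + ('Y - cst x.2) *: m2.
Proof.
rewrite -value0; split=> [/eqP|mE].
  by rewrite /value -Quotient.idealrBE subr0 => /asboolP.
by apply/eqP; rewrite /value -Quotient.idealrBE subr0; apply/asboolP.
Qed.

Lemma value_scale0 (f : {poly {poly K}}) m : value x m = 0 -> value x (f *: m) = 0.
Proof.
move=> /value_eq0[m1 [m2 ->]]; apply/value_eq0; exists (f *: m1), (f *: m2).
by rewrite scalerDr !scalerA !(mulrC f).
Qed.

Lemma value_scale_eq (f : {poly {poly K}}) m m' :
  value x m = value x m' -> value x (f *: m) = value x (f *: m').
Proof.
move=> mm'; apply/eqP; rewrite -subr_eq0 -valueN -valueD -scalerBr.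
by apply/eqP/value_scale0; rewrite valueD valueN mm' subrr.
Qed.

(** f - f(x) lies in the maximal ideal of x, by the factor theorem applied first in t_1, then in
    t_2. *)
Lemma value_eval (f : {poly {poly K}}) m :
  value x (f *: m) = value x (cst f.[x.1%:P].[x.2] *: m).
Proof.
apply/eqP; rewrite -subr_eq0 -valueN -valueD -scalerBl; apply/eqP/value_eq0.
have /factor_theorem[q qE] : root (f - (f.[x.1%:P])%:P) x.1%:P.
  by rewrite rootE hornerD hornerN hornerC subrr.
have /factor_theorem[q' q'E] : root (f.[x.1%:P] - (f.[x.1%:P].[x.2])%:P) x.2.
  by rewrite rootE hornerD hornerN hornerC subrr.
exists (q *: m), (q'%:P *: m); rewrite !scalerA -scalerDl; congr (_ *: _).
rewrite [_ * q]mulrC -qE [_ * q'%:P]mulrC.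
have -> : q'%:P * ('Y - cst x.2) = (q' * ('X - (x.2)%:P))%:P.
  by rewrite polyCM polyCB.
by rewrite -q'E polyCB /cst addrA subrK.
Qed.

End Fiber.
End Connection.

(** * Parallel transport *)

Section ComplexDerivatives.
Variable R : realType.
Local Notation C := R[i].
Implicit Types (f g df dg : R -> C) (s : R).

Lemma is_derive_C_cst (a : C) s : is_derive_C (fun=> a) (fun=> 0) s.
Proof. by split; exact: is_derive_cst. Qed.

Lemma is_derive_C_real s : is_derive_C (fun u => (u%:C)%C) (fun=> 1) s.
Proof. by split; [exact: is_derive_id | exact: is_derive_cst]. Qed.

Lemma is_derive_C_D f g df dg s : is_derive_C f df s -> is_derive_C g dg s ->
  is_derive_C (fun u => f u + g u) (fun u => df u + dg u) s.
Proof.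
move=> [fR fI] [gR gI]; split.
  have -> : (fun u => complex.Re (f u + g u)) =
      (fun u => complex.Re (f u)) + (fun u => complex.Re (g u)).
    by apply/funext => u; rewrite fctE; case: (f u) (g u) => [? ?] [? ?].
  by apply: is_derive_eq; case: (df s) (dg s) => [? ?] [? ?].
have -> : (fun u => complex.Im (f u + g u)) =
    (fun u => complex.Im (f u)) + (fun u => complex.Im (g u)).
  by apply/funext => u; rewrite fctE; case: (f u) (g u) => [? ?] [? ?].
by apply: is_derive_eq; case: (df s) (dg s) => [? ?] [? ?].
Qed.

Lemma is_derive_C_M f g df dg s : is_derive_C f df s -> is_derive_C g dg s ->
  is_derive_C (fun u => f u * g u) (fun u => df u * g u + f u * dg u) s.
Proof.
move=> [fR fI] [gR gI]; split.
  have -> : (fun u => complex.Re (f u * g u)) =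
      (fun u => complex.Re (f u)) * (fun u => complex.Re (g u)) -
      (fun u => complex.Im (f u)) * (fun u => complex.Im (g u)).
    by apply/funext => u; rewrite !fctE; case: (f u) (g u) => [? ?] [? ?].
  apply: is_derive_eq; case: (df s) (dg s) (f s) (g s) => [? ?] [? ?] [? ?] [? ?].
  by rewrite /= /GRing.scale /=; ring.
have -> : (fun u => complex.Im (f u * g u)) =
    (fun u => complex.Re (f u)) * (fun u => complex.Im (g u)) +
    (fun u => complex.Im (f u)) * (fun u => complex.Re (g u)).
  by apply/funext => u; rewrite !fctE; case: (f u) (g u) => [? ?] [? ?].
apply: is_derive_eq; case: (df s) (dg s) (f s) (g s) => [? ?] [? ?] [? ?] [? ?].
by rewrite /= /GRing.scale /=; ring.
Qed.

Lemma is_derive_C_X n s :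
  is_derive_C (fun u => (u%:C)%C ^+ n) (fun u => (u%:C)%C ^+ n.-1 *+ n) s.
Proof.
elim: n => [|n IHn]; first exact: is_derive_C_cst.
have := is_derive_C_M (is_derive_C_real s) IHn.
rewrite (_ : (fun u => _ * _) = (fun u => (u%:C)%C ^+ n.+1)); last first.
  by apply/funext => u; rewrite exprS.
rewrite (_ : (fun u => _ + _) = (fun u => (u%:C)%C ^+ n *+ n.+1)) //.
apply/funext => u; rewrite mul1r mulrS; congr (_ + _).
by case: n {IHn} => [|n]; rewrite ?mulr0n ?mulr0 // mulrnAr -exprS.
Qed.

Lemma is_derive_C_sum (I : Type) (r : seq I) (f df : I -> R -> C) s :
  (forall i, is_derive_C (f i) (df i) s) ->
  is_derive_C (fun u => \sum_(i <- r) f i u) (fun u => \sum_(i <- r) df i u) s.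
Proof.
move=> fdf; elim: r => [|i r IHr].
  by under eq_fun do rewrite big_nil; split; rewrite big_nil; exact: is_derive_cst.
under eq_fun do rewrite big_cons.
by have [? ?] := is_derive_C_D (fdf i) IHr; split; rewrite big_cons.
Qed.

Lemma derive_C_0_cst f : (forall s, 0 <= s <= 1 -> is_derive_C f (fun=> 0) s) ->
  f 1 = f 0.
Proof.
move=> f0.
have gen (h : R -> R) : (forall s, 0 <= s <= 1 -> is_derive s 1 h 0) -> h 1 = h 0.
  move=> h0; have [s|| c _] := @MVT_segment R h (fun=> 0) 0 1 ler01.
  - by rewrite in_itv /= => /andP[s0 s1]; apply: h0; rewrite !ltW.
  - apply: derivable_within_continuous => s; rewrite in_itv /= => s01.
    by have := h0 s s01.
  - by rewrite mul0r => /eqP; rewrite subr_eq0 => /eqP.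
apply/eqP; rewrite eq_complex; apply/andP; split; apply/eqP.
  by apply: (gen (fun u => complex.Re (f u))) => s /f0 [].
by apply: (gen (fun u => complex.Im (f u))) => s /f0 [].
Qed.

End ComplexDerivatives.

Section DirectionalDerivative.
Variables (K : fieldType) (E : eqbun K).
Implicit Types (m : E) (c : K).

Definition lin (a b c : K) : {poly {poly K}} := cst a * 'X + cst b * 'Y + cst c.

Lemma nabla1_lin a b c m :
  nabla1 (lin a b c *: m) = cst a *: m + lin a b c *: nabla1 m.
Proof.
rewrite /lin !scalerDl -!scalerA !nabla1D !nabla1_cst nabla1_X nabla1_Y.
by rewrite scalerDr !addrA.
Qed.

Lemma nabla2_lin a b c m :
  nabla2 (lin a b c *: m) = cst b *: m + lin a b c *: nabla2 m.
Proof.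
rewrite /lin !scalerDl -!scalerA !nabla2D !nabla2_cst nabla2_X nabla2_Y.
by rewrite scalerDr !addrA [_ + cst b *: m]addrC.
Qed.

Lemma value_lin x a b c m :
  value x (lin a b c *: m) = value x (cst (a * x.1 + b * x.2 + c) *: m).
Proof. by rewrite value_eval /lin /cst !hornerE. Qed.

Definition along (d : K * K) m : E := cst d.1 *: nabla1 m + cst d.2 *: nabla2 m.

Section Direction.
Variable d : K * K.

Lemma alongD m m' : along d (m + m') = along d m + along d m'.
Proof. by rewrite /along nabla1D nabla2D !scalerDr addrACA. Qed.

Lemma along_cst c m : along d (cst c *: m) = cst c *: along d m.
Proof.
by rewrite /along nabla1_cst nabla2_cst scalerDr !scalerA !(mulrC (cst c)).
Qed.

Lemma along_sum (I : Type) (r : seq I) (P : pred I) (F : I -> E) :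
  along d (\sum_(i <- r | P i) F i) = \sum_(i <- r | P i) along d (F i).
Proof.
apply: big_morph; first exact: alongD.
by rewrite /along nabla1_0 nabla2_0 !scaler0 addr0.
Qed.

Lemma along_lin a b c m : along d (lin a b c *: m) =
  cst (a * d.1 + b * d.2) *: m + lin a b c *: along d m.
Proof.
rewrite /along nabla1_lin nabla2_lin !scalerDr !scalerA addrACA -scalerDl.
by rewrite !(mulrC (lin a b c)) cstD !cstM !(mulrC (cst a)) !(mulrC (cst b)).
Qed.

(** A power of [along d] expands into words in [nabla1] and [nabla2], which need not commute; this
    is why [killed] speaks of all words. *)
Lemma along_nilpotent m : exists n, iter n (along d) m = 0.
Proof.
have [n mn] := connection_nilpotent m; exists n; elim: n m mn => [|n IHn] m //.
move=> mn; rewrite iterSr; apply: IHn; case: mn => m1 m2.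
by apply: killedD; exact: killed_cst.
Qed.

Variables (x : K * K) (a b : K).
Hypothesis ab1 : a * d.1 + b * d.2 = 1.
Hypothesis K_char0 : forall n, n.+1%:R != 0 :> K.

(* tau s is an affine coordinate on the line x + K d, vanishing at x + s d, and
   rho is an equation of this line. *)
Definition tau (s : K) := lin a b (- (a * x.1 + b * x.2 + s)).
Definition rho := lin d.2 (- d.1) (d.1 * x.2 - d.2 * x.1).

Lemma along_tau s m : along d (tau s *: m) = m + tau s *: along d m.
Proof. by rewrite along_lin ab1 scale1r. Qed.

Lemma along_rho m : along d (rho *: m) = rho *: along d m.
Proof. by rewrite along_lin mulNr mulrC subrr cst0 scale0r add0r. Qed.

Definition line_point (s : K) : K * K := (x.1 + s * d.1, x.2 + s * d.2).

Lemma value_rho s m : value (line_point s) (rho *: m) = 0.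
Proof.
rewrite value_lin (_ : _ + _ = 0) ?cst0 ?scale0r ?value0 //=; ring.
Qed.

Lemma value_tau s u m : value (line_point u) (tau s *: m) =
  value (line_point u) (cst (u - s) *: m).
Proof.
rewrite value_lin; suff -> : a * (line_point u).1 + b * (line_point u).2 -
  (a * x.1 + b * x.2 + s) = u - s by [].
by rewrite /= -[u in RHS]mulr1 -ab1; ring.
Qed.

Lemma flat_vanish s m : along d m = 0 -> value (line_point s) m = 0 ->
  exists m', m = rho *: m'.
Proof.
move=> Dm /value_eq0[m1 [m2 mE]].
(* Since a d_1 + b d_2 = 1, [tau s] and [rho] generate the ideal of the point: its two coordinate
   functions are d_1 tau + b rho and d_2 tau - a rho. *)
apply: (@flat_point_vanish _ _ (along d) (tau s) K_char0 alongD along_cst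
  (along_tau s) along_nilpotent rho m
  (cst d.1 *: m1 + cst d.2 *: m2) (cst b *: m1 - cst a *: m2)) => //.
  exact: along_rho.
have c1 : cst a * cst d.1 + cst b * cst d.2 = 1 by rewrite -!cstM -cstD ab1.
rewrite mE !scalerDr scalerN addrACA -scalerN -scaleNr !scalerA -!scalerDl.
congr (_ *: _ + _ *: _); rewrite /tau /rho /lin /= !(cstD, cstN, cstM).
  by rewrite -[X in X - _]mul1r -[X in _ - (X + _)]mul1r -c1; ring.
by rewrite -[X in X - _]mul1r -[X in _ - (X + _)]mul1r -c1; ring.
Qed.

Lemma flat_unique s u m m' : along d m = 0 -> along d m' = 0 ->
  value (line_point s) m = value (line_point s) m' ->
  value (line_point u) m = value (line_point u) m'.
Proof.
move=> Dm Dm' mm'; have [||m'' mE] := @flat_vanish s (m - m').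
- by rewrite -scaleN1r -cst1 -cstN alongD along_cst Dm Dm' scaler0 addr0.
- by rewrite valueD valueN mm' subrr.
by apply/eqP; rewrite -subr_eq0 -valueN -valueD mE value_rho.
Qed.

Lemma flat_tau_expansion m : exists N (c : nat -> E),
  (forall n, along d (c n) = 0) /\
  forall N', (N <= N')%N -> m = \sum_(n < N') tau 0 ^+ n *: c n.
Proof.
have [N mN] := along_nilpotent m.
have [|||||c cP mE] := @flat_expansion _ _ (along d) (tau 0) K_char0 alongD
  along_cst (along_tau 0) (fun=> True) _ _ _ _ N m mN => //.
exists N, (fun n => if (n < N)%N then c n else 0); split=> [n|N' NN'].
  by case: ifP => _; [exact: (proj1 (cP n)) | exact: (flow_0 alongD)].
rewrite {1}mE -(subnKC NN') big_split_ord /= [X in _ + X]big1 ?addr0 => [|i _].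
  by apply: eq_bigr => i _; rewrite ltn_ord.
by rewrite ltnNge leq_addr scaler0.
Qed.

Lemma value_tau_exp u n m : value (line_point u) (tau 0 ^+ n *: m) =
  value (line_point u) (cst (u ^+ n) *: m).
Proof.
elim: n => [|n IHn]; first by rewrite !expr0 cst1.
rewrite !exprS -scalerA value_tau subr0 cstM -!scalerA.
exact: value_scale_eq.
Qed.

Lemma along_tau_exp n m : along d m = 0 ->
  along d (tau 0 ^+ n *: m) = cst n%:R *: (tau 0 ^+ n.-1 *: m).
Proof.
case: n => [|n] Dm; first by rewrite expr0 scale1r Dm cst0 scale0r.
rewrite (flow_exp (along_tau 0)) //.
by rewrite /cst !polyC_natr scaler_nat.
Qed.

(** At the parameter u the coordinate [tau 0] has the value u, so the covariant derivative there
    equals the value of a combination of flat sections with constant coefficients. Such a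
    combination is flat, and vanishing at u it vanishes at every u'. *)
Lemma flat_family_expansion r (m : 'I_r -> E) : exists N (c : 'I_r -> nat -> E),
  [/\ forall l n, along d (c l n) = 0,
      forall u (h : 'I_r -> K),
        value (line_point u) (\sum_l cst (h l) *: m l) =
        value (line_point u) (\sum_l \sum_(n < N) cst (h l * u ^+ n) *: c l n) &
      forall u (h dh : 'I_r -> K),
        value (line_point u)
          (\sum_l (cst (dh l) *: m l + cst (h l) *: along d (m l))) = 0 ->
        forall u', value (line_point u') (\sum_l \sum_(n < N)
          cst (dh l * u ^+ n + h l * (u ^+ n.-1 *+ n)) *: c l n) = 0].
Proof.
have [Nc NcP] := choice (fun l => flat_tau_expansion (m l)).
have [c cP] := choice NcP.
pose N := \max_l Nc l.
have Dc l n : along d (c l n) = 0 by case: (cP l).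
have mE l : m l = \sum_(n < N) tau 0 ^+ n *: c l n.
  by have [_] := cP l; apply; exact: leq_bigmax.
exists N, c; split; [exact: Dc | move=> u h | move=> u h dh mu0 u'].
  rewrite !value_sum; apply: eq_bigr => l _; rewrite mE scaler_sumr !value_sum.
  apply: eq_bigr => n _; rewrite cstM -scalerA.
  by apply: value_scale_eq; exact: value_tau_exp.
rewrite -(value0 E (line_point u')); apply: (@flat_unique u).
- rewrite along_sum big1 // => l _; rewrite along_sum big1 // => n _.
  by rewrite along_cst Dc scaler0.
- exact: (flow_0 alongD).
rewrite value0 -[RHS]mu0 !value_sum; apply: eq_bigr => l _.
rewrite {1 2}mE along_sum !scaler_sumr -big_split /= !value_sum.
apply: eq_bigr => n _; rewrite along_tau_exp // -mulr_natl.
rewrite cstD scalerDl !valueD !cstM -!scalerA; congr (_ + _).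
  by apply: value_scale_eq; rewrite value_tau_exp.
by apply: value_scale_eq; apply: value_scale_eq; rewrite value_tau_exp.
Qed.

End Direction.

Definition seg_dir (x y : K * K) : K * K := (y.1 - x.1, y.2 - x.2).

Lemma along_vertical m : nabla2 m = 0 -> along (seg_dir (0, 0) (0, -1)) m = 0.
Proof. by move=> m0; rewrite /along /= subrr cst0 scale0r m0 scaler0 addr0. Qed.

Lemma along_diagonal m : nabla1 m = nabla2 m ->
  along (seg_dir (0, -1) (-1, 0)) m = 0.
Proof.
by move=> m0; rewrite /along /= subr0 sub0r opprK cstN cst1 scaleN1r scale1r m0 addNr.
Qed.

Lemma along_horizontal m : nabla1 m = 0 -> along (seg_dir (-1, 0) (0, 0)) m = 0.
Proof. by move=> m0; rewrite /along /= subrr cst0 scale0r m0 scaler0 add0r. Qed.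

Lemma seg_dir_vertical : 0 * (seg_dir (0, 0) (0, -1)).1 +
  -1 * (seg_dir (0, 0) (0, -1)).2 = 1.
Proof. by rewrite /=; ring. Qed.

Lemma seg_dir_diagonal : 0 * (seg_dir (0, -1) (-1, 0)).1 +
  1 * (seg_dir (0, -1) (-1, 0)).2 = 1.
Proof. by rewrite /=; ring. Qed.

Lemma seg_dir_horizontal : 1 * (seg_dir (-1, 0) (0, 0)).1 +
  0 * (seg_dir (-1, 0) (0, 0)).2 = 1.
Proof. by rewrite /=; ring. Qed.

Lemma value_constant_family d x m : along d m = 0 ->
  value x (\sum_(l < 1) (cst 0 *: m +
    cst 1 *: (cst d.1 *: nabla1 m + cst d.2 *: nabla2 m))) = 0.
Proof.
by move=> Dm; rewrite big_ord1 -/(along d m) Dm cst0 scale0r scaler0 addr0 value0.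
Qed.

Lemma constant_family m : \sum_(l < 1) cst 1 *: m = m.
Proof. by rewrite big_ord1 cst1 scale1r. Qed.

(** E is a direct summand of a free module, so the evaluated coordinates in that module detect zero
    in each fiber. They turn equations in E_x into scalar equations, to which calculus applies. *)
Lemma value_coordinates : exists r (coord : K * K -> 'I_r -> E -> K),
  [/\ forall x k m m', coord x k (m + m') = coord x k m + coord x k m',
      forall x k c m, coord x k (cst c *: m) = c * coord x k m &
      forall x m, value x m = 0 <-> forall k, coord x k m = 0].
Proof.
have [r [f [g fgK]]] := eqbun_projective E.
pose coord (x : K * K) k m := (f m 0 k).[x.1%:P].[x.2].
have coordD x k m m' : coord x k (m + m') = coord x k m + coord x k m'.
  by rewrite /coord linearD mxE !hornerE.
have coordZ x k p m : coord x k (p *: m) = p.[x.1%:P].[x.2] * coord x k m.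
  by rewrite /coord linearZ mxE !hornerE.
exists r, coord; split=> // [x k c m|x m]; first by rewrite coordZ /cst !hornerE.
split=> [/value_eq0[m1 [m2 ->]] k|m0].
  by rewrite coordD !coordZ /cst !hornerE !subrr !mul0r addr0.
rewrite -[m]fgK (row_sum_delta (f m)) linear_sum value_sum big1 // => k _.
rewrite linearZ value_eval (_ : _.[_].[_] = coord x k m) //.
by rewrite m0 cst0 scale0r value0.
Qed.

Lemma value_coordinates_family r N (c : 'I_r -> nat -> E) x :
  exists p (a : 'I_p -> 'I_r -> nat -> K),
  (forall h : 'I_r -> nat -> K,
    value x (\sum_l \sum_(n < N) cst (h l n) *: c l n) = 0 <->
    forall k, \sum_l \sum_(n < N) h l n * a k l n = 0) /\
  (forall h h' : 'I_r -> nat -> K,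
    (forall k, \sum_l \sum_(n < N) h l n * a k l n =
               \sum_l \sum_(n < N) h' l n * a k l n) ->
    value x (\sum_l \sum_(n < N) cst (h l n) *: c l n) =
    value x (\sum_l \sum_(n < N) cst (h' l n) *: c l n)).
Proof.
suff [p [a aP]] : exists p (a : 'I_p -> 'I_r -> nat -> K),
    forall h : 'I_r -> nat -> K,
    value x (\sum_l \sum_(n < N) cst (h l n) *: c l n) = 0 <->
    forall k, \sum_l \sum_(n < N) h l n * a k l n = 0.
  exists p, a; split=> // h h' hh'; apply/eqP; rewrite -subr_eq0 -valueN -valueD.
  rewrite -sumrB; under eq_bigr do rewrite -sumrB.
  under eq_bigr do under eq_bigr do rewrite -scalerBl -cstN -cstD.
  apply/eqP/(aP (fun l n => h l n - h' l n)) => k.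
  under eq_bigr do under eq_bigr do rewrite mulrBl.
  under eq_bigr do rewrite sumrB.
  by rewrite sumrB hh' subrr.
have [p [coord [coordD coord_cst coord0]]] := value_coordinates.
exists p, (fun k l n => coord x k (c l n)) => h.
have c0 k : coord x k 0 = 0 by rewrite -(scale0r 0) -cst0 coord_cst mul0r.
have cE k : coord x k (\sum_l \sum_(n < N) cst (h l n) *: c l n) =
    \sum_l \sum_(n < N) h l n * coord x k (c l n).
  rewrite (big_morph _ (coordD x k) (c0 k)); apply: eq_bigr => l _.
  rewrite (big_morph _ (coordD x k) (c0 k)); apply: eq_bigr => n _.
  exact: coord_cst.
by rewrite coord0; split=> h0 k; have := h0 k; rewrite cE.
Qed.

End DirectionalDerivative.

Section Transport.
Variables (R : realType) (E : eqbun R[i]).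
Local Notation C := R[i].

Lemma complex_char0 n : n.+1%:R != 0 :> C.
Proof. by rewrite pnatr_eq0. Qed.

Variables (x y : C * C) (a b : C).
Local Notation d := (seg_dir x y).
Hypothesis ab1 : a * d.1 + b * d.2 = 1.
Local Notation pt := (line_point d x).

Lemma line_point0 : pt 0 = x.
Proof. by rewrite /line_point !mul0r !addr0 -surjective_pairing. Qed.

Lemma line_point1 : pt 1 = y.
Proof. by rewrite /line_point !mul1r /= !subrKC -surjective_pairing. Qed.

Lemma flat_transport (m : E) : along d m = 0 -> transport (value x m) (value y m).
Proof.
move=> Dm; exists 1%N, (fun=> m), (fun _ _ => 1), (fun _ _ => 0).
split=> [l s _|s _||]; first exact: is_derive_C_cst.
- exact: (value_constant_family (segment x y s) Dm).
- exact: (congr1 (value x) (esym (constant_family m))).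
- exact: (congr1 (value y) (esym (constant_family m))).
Qed.

(* Expanding the m_l in flat sections turns the equation of parallel transport
   into the vanishing of the derivative of the coefficients. *)
Lemma transport_flat (e : fiber E x) (e' : fiber E y) : transport e e' ->
  exists m : E, [/\ along d m = 0, e = value x m & e' = value y m].
Proof.
move=> [r [m [f [df [fP fflat -> ->]]]]].
have [N [c [Dc valE flatE]]] := @flat_family_expansion _ E d x a b ab1 complex_char0 r m.
have [p [co [coP coE]]] := value_coordinates_family N c y.
(* The coordinates are taken at the fixed point y and not at the moving point of the segment;
   [flatE] carries the vanishing of the derivative over to y. *)
pose H k s := \sum_l \sum_(n < N) f l s * (s%:C)%C ^+ n * co k l n.
have H01 k : H k 1 = H k 0.
  apply: derive_C_0_cst => s s01.
  pose dH u := \sum_l \sum_(n < N)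
    ((df l u * (u%:C)%C ^+ n + f l u * ((u%:C)%C ^+ n.-1 *+ n)) * co k l n +
     f l u * (u%:C)%C ^+ n * 0).
  have HdH : is_derive_C (H k) dH s.
    apply: is_derive_C_sum => l; apply: is_derive_C_sum => n.
    apply: is_derive_C_M; last exact: is_derive_C_cst.
    by apply: is_derive_C_M; [exact: fP | exact: is_derive_C_X].
  suff dH0 : dH s = 0 by move: HdH; rewrite /is_derive_C dH0.
  have := flatE (s%:C)%C (fun l => f l s) (fun l => df l s) (fflat s s01) 1.
  rewrite line_point1.
  move=> /(iffLR (coP (fun l n => df l s * (s%:C)%C ^+ n +
    f l s * ((s%:C)%C ^+ n.-1 *+ n))))/(_ k) co0.
  rewrite -[RHS]co0; apply: eq_bigr => l _; apply: eq_bigr => n _.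
  by rewrite mulr0 addr0.
have v0 := valE 0 (fun l => f l 0); have v1 := valE 1 (fun l => f l 1).
rewrite line_point0 in v0; rewrite line_point1 in v1.
(* The coefficients frozen at time 0; by [H01] those at time 1 give the same value at y. *)
exists (\sum_l \sum_(n < N) cst (f l 0 * 0 ^+ n) *: c l n).
split; [|exact: v0|].
  rewrite along_sum big1 // => l _; rewrite along_sum big1 // => n _.
  by rewrite along_cst Dc scaler0.
rewrite v1; exact: (coE (fun l n => f l 1 * 1 ^+ n) (fun l n => f l 0 * 0 ^+ n)).
Qed.

Lemma transport_unique (m : E) (e : fiber E x) (e' : fiber E y) :
  along d m = 0 -> transport e e' -> e = value x m -> e' = value y m.
Proof.
move=> Dm /transport_flat[n [Dn -> ->]].
have := @flat_unique _ E d x a b ab1 complex_char0 0 1 n m Dn Dm.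
by rewrite line_point0 line_point1.
Qed.

End Transport.

(** * Sections of the Radon-Penrose transform *)

Section RadonPenroseSections.
Variables (K : fieldType) (E : eqbun K).
Implicit Types (s : int * int -> E) (m : E).

Definition rp_flat s : Prop :=
  forall j k, nabla2 (s (j - 1, k)) - nabla1 (s (j, k - 1)) = 0.
Definition rp_degree0 s : Prop := forall jk, s jk != 0 -> jk.1 + jk.2 = 0.

Lemma seq_norm_bound (I : eqType) (r : seq I) (w : I -> int) :
  exists N : nat, forall i, i \in r -> - N%:Z <= w i.
Proof.
have [b bP] := seq_lower_bound r w; exists `|b|%N => i /bP; lia.
Qed.

(** Over [U12] both v_1 and v_2 are inverted, so finite support already bounds the poles. *)
Lemma rp_section12 s : finsupp s -> rp_degree0 s -> rp_flat s ->
  rp_section U12 s.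
Proof.
move=> s_fin s_deg s_flat; split=> //.
have [r _ s0] := finsupp_seq s_fin.
have [N1 N1P] := seq_norm_bound r fst; have [N2 N2P] := seq_norm_bound r snd.
exists (N1 + N2)%N => jk sjk /=.
have jkr : jk \in r by apply: contraNT sjk => /s0 ->.
by move: (N1P _ jkr) (N2P _ jkr); rewrite /= !muln1; case: jk {sjk jkr} => j k /=; lia.
Qed.

Lemma rp_section_sub U s : rp_section U s -> rp_section U12 s.
Proof. by move=> [s_fin s_deg _ s_flat]; exact: rp_section12. Qed.

Lemma finsupp_map (f : int * int -> int * int) (g : int * int -> int * int) s :
  cancel f g -> finsupp s -> finsupp (s \o f).
Proof.
move=> fK /finsupp_seq[r _ s0]; apply: (@seq_finsupp _ _ _ (map g r)) => jk.
by move=> jkr; apply: s0; apply: contra jkr => jkr; apply/mapP; exists (f jk).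
Qed.

Definition rp_shift s : int * int -> E := fun jk => s (jk.1 + 1, jk.2 - 1).

Lemma rp_shift_finsupp s : finsupp s -> finsupp (rp_shift s).
Proof.
apply: (@finsupp_map _ (fun jk => (jk.1 - 1, jk.2 + 1))) => -[j k] /=.
by rewrite addrK subrK.
Qed.

Lemma rp_shift_section s : rp_section U12 s -> rp_section U12 (rp_shift s).
Proof.
move=> [s_fin s_deg _ s_flat]; apply: rp_section12.
- exact: rp_shift_finsupp.
- by move=> jk /s_deg /=; rewrite addrACA subrr addr0.
- by move=> j k; rewrite /rp_shift /= addrAC; exact: s_flat.
Qed.

Lemma finsupp_scale (f : {poly {poly K}}) s :
  finsupp s -> finsupp (fun jk => f *: s jk).
Proof.
move=> /finsupp_seq[r _ s0]; apply: (@seq_finsupp _ _ _ r) => jk /s0 ->.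
exact: scaler0.
Qed.

Lemma rp_mul_finsupp s : finsupp s -> finsupp (rp_mul_v0v1 s).
Proof.
move=> s_fin; rewrite /rp_mul_v0v1; under eq_fun do rewrite -scaleN1r.
apply: finsupp_scale; apply: finsuppD; apply: finsupp_scale => //.
exact: rp_shift_finsupp.
Qed.

Lemma rp_mul_section s : rp_section U12 s -> rp_section U12 (rp_mul_v0v1 s).
Proof.
move=> [s_fin s_deg _ s_flat]; apply: rp_section12.
- exact: rp_mul_finsupp.
- move=> jk; rewrite /rp_mul_v0v1 oppr_eq0.
  have [s0|/s_deg //] := eqVneq (s jk) 0.
  rewrite s0 scaler0 add0r => /eqP sn0.
  have : s (jk.1 + 1, jk.2 - 1) != 0.
    by apply/eqP => s0'; rewrite s0' scaler0 in sn0.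
  by move=> /s_deg /=; rewrite addrACA subrr addr0.
- move=> j k; rewrite /rp_mul_v0v1 /= nabla1N nabla2N nabla1D nabla2D.
  rewrite nabla1_X nabla2_X nabla1_Y nabla2_Y subrK.
  have /eqP := s_flat j k; rewrite subr_eq0 => /eqP ->.
  have /eqP := s_flat (j + 1) (k - 1); rewrite addrK subr_eq0 => /eqP ->.
  by rewrite addrCA addrA subrr.
Qed.

(* Minus the derivative along the fibers of p_0, divided by v_2; it maps t_1
   to 1, so that flat sections are obtained by expansion in powers of t_1. *)
Definition rp_flow s : int * int -> E :=
  fun jk => nabla1 (s jk) - nabla2 (s (jk.1 - 1, jk.2 + 1)).

Lemma rp_flow_killed n s : (forall jk, killed n (s jk)) -> iter n rp_flow s = 0.
Proof.
elim: n s => [|n IHn] s sn; first by apply/funext => jk; exact: sn.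
rewrite iterSr; apply: IHn => jk; apply: killedD; first by case: (sn jk).
rewrite -scaleN1r -cst1 -cstN; apply: killed_cst.
by case: (sn (jk.1 - 1, jk.2 + 1)).
Qed.

Hypothesis K_char0 : forall n, n.+1%:R != 0 :> K.

(** Expand a constant family with value e in powers of t_1 for [rp_flow]. The constant term is flat
    and differs from the family by a multiple of t_1, which vanishes at the origin. The predicate
    [P] keeps finite support and degree zero through the expansion. *)
Lemma flat_section_through (e : fiber E (0, 0)) : exists2 s, rp_section U12 s &
  forall jk, value (0, 0) (s jk) = if jk == (0, 0) then e else 0.
Proof.
have [m mE] := value_surj e; pose s0 (jk : int * int) := if jk == (0, 0) then m else 0.
have [n mn] := connection_nilpotent m.
(* One more iteration than necessary, so that the expansion has a constant term even for n = 0. *)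
have s0n : iter n.+1 rp_flow s0 = 0.
  apply: rp_flow_killed => jk; rewrite /s0; case: ifP => _; last exact: killed_0.
  exact: killed_le mn.
pose P s := finsupp s /\ rp_degree0 s.
have rp_flowD s s' : rp_flow (s + s') = rp_flow s + rp_flow s'.
  apply/funext => jk; rewrite /rp_flow !fctE nabla1D nabla2D.
  by rewrite opprD addrACA.
have rp_flow_cst c s : rp_flow (cst c *: s) = cst c *: rp_flow s.
  by apply/funext => jk; rewrite /rp_flow !fctE nabla1_cst nabla2_cst scalerBr.
have rp_flow_X s : rp_flow ('X *: s) = s + 'X *: rp_flow s.
  by apply/funext => jk; rewrite /rp_flow !fctE nabla1_X nabla2_X scalerBr addrA.
have PD s s' : P s -> P s' -> P (s + s').
  move=> [sf sd] [s'f s'd]; split; first exact: finsuppD.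
  move=> jk; have [sjk|/sd //] := eqVneq (s jk) 0.
  by rewrite fctE sjk add0r => /s'd.
have Pscale f s : P s -> P (f *: s).
  move=> [sf sd]; split; first exact: finsupp_scale.
  by move=> jk sjk; apply: sd; apply: contraNneq sjk => sjk; rewrite fctE sjk scaler0.
have Pflow s : P s -> P (rp_flow s).
  move=> [sf sd]; split.
    have /finsupp_seq[r _ s0r] := sf.
    apply: (@seq_finsupp _ _ _ (r ++ [seq (jk.1 + 1, jk.2 - 1) | jk <- r])) => jk.
    rewrite mem_cat negb_or => /andP[jkr jkr']; rewrite /rp_flow s0r // s0r.
      by rewrite nabla1_0 nabla2_0 subrr.
    apply: contra jkr' => jkr'; apply/mapP; exists (jk.1 - 1, jk.2 + 1) => //=.
    by rewrite subrK addrK -surjective_pairing.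
  move=> jk; have [sjk|/sd //] := eqVneq (s jk) 0.
  rewrite /rp_flow sjk nabla1_0 add0r oppr_eq0 => /eqP sjk'.
  have : s (jk.1 - 1, jk.2 + 1) != 0.
    by apply/eqP => e0; rewrite e0 nabla2_0 in sjk'.
  by move=> /sd /=; rewrite addrACA addNr addr0.
have Ps0 : P s0.
  split; first by apply: (@seq_finsupp _ _ _ [:: (0, 0)]) => jk;
    rewrite mem_seq1 /s0 => /negPf ->.
  by move=> jk; rewrite /s0; case: (jk =P (0, 0)) => [->|_]; rewrite ?eqxx.
have [c cP s0E] := @flat_expansion _ (int * int -> E) rp_flow 'X K_char0
  rp_flowD rp_flow_cst rp_flow_X P PD (fun a => Pscale (cst a)) (Pscale 'X) Pflow
  n.+1 s0 s0n Ps0.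
have [flow0 [c_fin c_deg]] := cP 0%N.
exists (c 0%N).
  apply: rp_section12 => // j k; have := congr1 (@^~ (j, k - 1)) flow0.
  rewrite /rp_flow /= subrK => /eqP; rewrite subr_eq0 => /eqP ->.
  exact: subrr.
move=> jk; have /(congr1 (@^~ jk)) := s0E.
rewrite big_ord_recl /= expr0 scale1r /s0 => s0jk.
rewrite -mE -(value0 E (0, 0)) -(fun_if (value (0, 0))) s0jk.
rewrite [in RHS]fctE valueD -[LHS]addr0; congr (_ + _).
rewrite (@big_morph _ _ (fun s : int * int -> E => s jk) 0 +%R 0 +%R) //.
rewrite value_sum big1 // => i _.
rewrite fctE exprS -scalerA value_eval hornerX /=.
by rewrite hornerC cst0 scale0r value0.
Qed.

End RadonPenroseSections.

(** * Monomial sections and their values on the sides of the triangle *)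

Section Lift.
Variables (K : fieldType) (V : mhs K) (E : eqbun K).
Local Notation W := (@weight K V).
Local Notation F' := (@hodge1 K V).
Local Notation F'' := (@hodge2 K V).
Variable Phi : (int * int -> E) -> (int * int * int -> V).
Hypothesis hPhi : rees_iso Phi.
Implicit Types (s : int * int -> E) (z : K * K) (c : V) (i j k : int)
  (x : int * int * int -> V) (jk : int * int).

Definition mono (c : V) (i j k : int) : int * int * int -> V :=
  fun l => if l == (i, j, k) then c else 0.

(** A Hodge condition is only imposed for a variable that is not inverted on the chart; for an
    inverted one, a large power of it moves the exponent to where the filtration is all of V. *)
Lemma mono_rees U c i j k : i + j + k = 0 -> c \in W i ->
    ((chart_exp U).1 = 0%N -> c \in F' (- j)) ->
    ((chart_exp U).2 = 0%N -> c \in F'' (- k)) ->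
  rees_section U (mono c i j k).
Proof.
move=> ijk cW cF' cF''; split.
  by move=> l; rewrite /mono; case: (l =P (i, j, k)) => [->|_]; rewrite ?eqxx.
have [_ [N1 [F'f _]]] := @hodge1_finite_decr _ V.
have [_ [N2 [F''f _]]] := @hodge2_finite_decr _ V.
exists (N1 + N2 + `|j| + `|k|)%N; set N := (_ + _)%N; split.
  apply: (@seq_finsupp _ _ _
    [:: (i, j + (N * (chart_exp U).1)%:Z, k + (N * (chart_exp U).2)%:Z)]).
  move=> [[i' j'] k']; rewrite mem_seq1 /mul_mon /mono /=; apply: contraNeq.
  by case: (_ =P (i, j, k)) => [[-> <- <-] _|_ /eqP//]; rewrite !subrK.
move=> i' j' k'; rewrite /mul_mon /mono /=; case: eqP => [[-> jE kE]|_]; last first.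
  exact: mem0v.
rewrite !memv_cap cW /=; apply/andP; split.
  have [e0|e0] := eqVneq (chart_exp U).1 0%N.
    by move: jE (cF' e0); rewrite e0 muln0 subr0 => ->.
  by rewrite F'f ?memvf // /N; move: jE; case: (U) e0 => //=; lia.
have [e0|e0] := eqVneq (chart_exp U).2 0%N.
  by move: kE (cF'' e0); rewrite e0 muln0 subr0 => ->.
by rewrite F''f ?memvf // /N; move: kE; case: (U) e0 => //=; lia.
Qed.

Lemma mono_rees12 c i j k : i + j + k = 0 -> c \in W i ->
  rees_section U12 (mono c i j k).
Proof. by move=> ijk cW; apply: mono_rees. Qed.

Definition lift x : int * int -> E :=
  xget (fun=> 0) [set s | rp_section U12 s /\ Phi s = x].

(** Surjectivity over U yields a preimage regular on U, and injectivity over [U12] identifies it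
    with [lift x]. Regularity at v_1 = 0 or v_2 = 0 can thus be read off the Rees side. *)
Lemma lift_section U x : rees_section U x ->
  rp_section U (lift x) /\ Phi (lift x) = x.
Proof.
move=> /(rees_iso_surj hPhi)[s sU sx].
have s12 := rp_section_sub sU.
have [l12 lx] : rp_section U12 (lift x) /\ Phi (lift x) = x.
  by apply: (@xgetPex _ (fun=> 0) [set s | rp_section U12 s /\ Phi s = x]); exists s.
by split=> //; rewrite (rees_iso_inj hPhi l12 s12) ?sx.
Qed.

Lemma lift_Phi s : rp_section U12 s -> lift (Phi s) = s.
Proof.
move=> s12; have [l12 ls] := lift_section (rees_iso_section hPhi s12).
exact: (rees_iso_inj hPhi l12 s12 ls).
Qed.

Lemma rp_sectionD s s' : rp_section U12 s -> rp_section U12 s' ->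
  rp_section U12 (fun jk => s jk + s' jk : E).
Proof.
move=> [sf sd _ sE] [s'f s'd _ s'E]; apply: rp_section12; first exact: finsuppD.
  move=> jk; have [sjk|/sd //] := eqVneq (s jk) 0.
  by rewrite sjk add0r => /s'd.
move=> j k; rewrite nabla1D nabla2D opprD addrACA.
by rewrite (sE j k) (s'E j k) addr0.
Qed.

Lemma liftD x y : rees_section U12 x -> rees_section U12 y ->
  lift (fun l => x l + y l) = (fun jk => lift x jk + lift y jk).
Proof.
move=> /lift_section[xs {1}<-] /lift_section[ys {1}<-].
by rewrite -(rees_isoD hPhi) // lift_Phi //; exact: rp_sectionD.
Qed.

(* The section of the Radon-Penrose transform corresponding to
   c v_0^i v_1^j v_2^k. *)
Definition lmono c i j k := lift (mono c i j k).

Lemma lmonoP U c i j k : i + j + k = 0 -> c \in W i ->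
    ((chart_exp U).1 = 0%N -> c \in F' (- j)) ->
    ((chart_exp U).2 = 0%N -> c \in F'' (- k)) ->
  rp_section U (lmono c i j k) /\ Phi (lmono c i j k) = mono c i j k.
Proof. by move=> *; apply: lift_section; exact: mono_rees. Qed.

Lemma lmono12 c i j k : i + j + k = 0 -> c \in W i ->
  rp_section U12 (lmono c i j k) /\ Phi (lmono c i j k) = mono c i j k.
Proof. by move=> ijk cW; apply: lmonoP. Qed.

Lemma lmonoD c c' i j k jk : i + j + k = 0 -> c \in W i -> c' \in W i ->
  lmono (c + c') i j k jk = lmono c i j k jk + lmono c' i j k jk.
Proof.
move=> ijk cW c'W.
have := liftD (mono_rees12 ijk cW) (mono_rees12 ijk c'W).
move=> /(congr1 (@^~ jk)) /= <-; rewrite /lmono; congr (lift _ jk).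
by apply/funext => l; rewrite /mono; case: eqP => _ //; rewrite addr0.
Qed.

Lemma lmono0 i j k jk : i + j + k = 0 -> lmono 0 i j k jk = 0.
Proof.
move=> ijk; apply: (addrI (lmono 0 i j k jk)).
by rewrite -lmonoD ?mem0v // !addr0.
Qed.

Lemma lmono_sum (I : Type) (r : seq I) (u : I -> V) i j k jk : i + j + k = 0 ->
  (forall a, u a \in W i) ->
  lmono (\sum_(a <- r) u a) i j k jk = \sum_(a <- r) lmono (u a) i j k jk.
Proof.
move=> ijk uW; elim: r => [|a r IHr]; first by rewrite !big_nil lmono0.
by rewrite !big_cons lmonoD ?IHr // rpred_sum.
Qed.

Lemma lmono_shift c i j k : i + j + k = 0 -> c \in W i ->
  lmono c i (j - 1) (k + 1) = rp_shift (lmono c i j k).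
Proof.
move=> ijk cW; have [s12 sE] := lmono12 ijk cW.
rewrite -[RHS]lift_Phi; last exact: rp_shift_section.
rewrite [Phi (rp_shift _)](rees_iso_v2v1 hPhi s12) sE; congr lift.
apply/funext => -[[i' j'] k']; rewrite /mul_mon /mono /= !xpair_eqE opprK.
by congr (if _ then _ else _); lia.
Qed.

Lemma lmono_mul c i j k : i + j + k = 0 -> c \in W i ->
  lmono c (i + 1) (j - 1) k = rp_mul_v0v1 (lmono c i j k).
Proof.
move=> ijk cW; have [s12 sE] := lmono12 ijk cW.
rewrite -[RHS]lift_Phi; last exact: rp_mul_section.
rewrite (rees_iso_v0v1 hPhi s12) sE; congr lift.
apply/funext => -[[i' j'] k']; rewrite /mono /= !xpair_eqE.
by congr (if _ then _ else _); lia.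
Qed.

Lemma value_rp_mul z s jk : value z (rp_mul_v0v1 s jk) =
  - (value z (cst z.1 *: s jk) + value z (cst z.2 *: rp_shift s jk)).
Proof.
rewrite /rp_mul_v0v1 valueN valueD; congr (- (_ + _)).
  by rewrite [LHS]value_eval hornerX hornerC.
  by rewrite [LHS]value_eval hornerC hornerX.
Qed.

Lemma mem_weight_le c i i' : i <= i' -> c \in W i -> c \in W i'.
Proof. by move=> /(@weight_le _ V)/subvP; apply. Qed.

(* The lines through (0,-1) form the locus v_0 = v_2. *)
Lemma lmono_at_v02 c i j k (r : nat) jk : i + j + k + r%:Z = 0 -> c \in W i ->
  value (0, -1) (lmono c (i + r%:Z) j k jk) =
  value (0, -1) (lmono c i j (k + r%:Z) jk).
Proof.
elim: r k => [|r IHr] k ijk cW; first by rewrite !addr0.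
have cWr : c \in W (i + r%:Z) by apply: mem_weight_le cW; lia.
have e : i + r%:Z + (j + 1) + k = 0 by lia.
rewrite (_ : i + r.+1%:Z = i + r%:Z + 1); last by lia.
(* One factor v_0 is written as (v_0 / v_1) v_1. At (0,-1) the function v_0 / v_1 = -t_1 - t_2 v_2 /
   v_1 becomes v_2 / v_1. *)
rewrite -{1}[j](addrK 1) lmono_mul // value_rp_mul /=.
rewrite cst0 scale0r value0 add0r cstN cst1 scaleN1r valueN opprK.
rewrite -lmono_shift // addrK IHr //; last by lia.
by rewrite (_ : k + 1 + r%:Z = k + r.+1%:Z) //; lia.
Qed.

(* The lines through (-1,0) form the locus v_0 = v_1. *)
Lemma lmono_at_v01 c i j k (r : nat) jk : i + j + k + r%:Z = 0 -> c \in W i ->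
  value (-1, 0) (lmono c (i + r%:Z) j k jk) =
  value (-1, 0) (lmono c i (j + r%:Z) k jk).
Proof.
elim: r j => [|r IHr] j ijk cW; first by rewrite !addr0.
have cWr : c \in W (i + r%:Z) by apply: mem_weight_le cW; lia.
have e : i + r%:Z + (j + 1) + k = 0 by lia.
rewrite (_ : i + r.+1%:Z = i + r%:Z + 1); last by lia.
rewrite -{1}[j](addrK 1) lmono_mul // value_rp_mul /=.
rewrite cst0 scale0r value0 addr0 cstN cst1 scaleN1r valueN opprK.
rewrite IHr //; last by lia.
by rewrite (_ : j + 1 + r%:Z = j + r.+1%:Z) //; lia.
Qed.

(* The restriction of s to the line v = (1,1,1) through (0,-1) and (-1,0). *)
Definition rp_sum (s : int * int -> E) : E := \sum_(jk \in [set: int * int]) s jk.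

Lemma shift_bij : bijective (fun jk : int * int => (jk.1 + 1, jk.2 - 1)).
Proof.
by exists (fun jk => (jk.1 - 1, jk.2 + 1)) => -[j k] /=; rewrite ?addrK ?subrK.
Qed.

Lemma rp_sum_shift s : rp_sum (rp_shift s) = rp_sum s.
Proof. by rewrite /rp_sum [RHS](reindex_fsbigT _ _ shift_bij). Qed.

Lemma rp_sum_scale (f : {poly {poly K}}) s : finsupp s ->
  rp_sum (fun jk => f *: s jk) = f *: rp_sum s.
Proof.
by move=> sf; rewrite /rp_sum (fsum_morph (scaler0 _ f) (scalerDr f) sf).
Qed.

(** At v = (1,1,1), multiplication by v_0 / v_1 is multiplication by -(t_1 + t_2), which is 1 at
    z. *)
Lemma rp_sum_mul z s : finsupp s -> z.1 + z.2 = -1 ->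
  value z (rp_sum (rp_mul_v0v1 s)) = value z (rp_sum s).
Proof.
move=> sf z12; have shf := rp_shift_finsupp sf.
have -> : rp_sum (rp_mul_v0v1 s) = - ('X *: rp_sum s + 'Y *: rp_sum s).
  rewrite -{2}(rp_sum_shift s) -!rp_sum_scale //.
  rewrite /rp_sum -fsumD; [|exact: finsupp_scale..].
  rewrite (fsum_morph (oppr0 E) (@opprD E)) //.
  by apply: finsuppD; exact: finsupp_scale.
rewrite -scalerDl valueN value_eval !hornerE z12 cstN cst1 scaleN1r valueN.
exact: opprK.
Qed.

(** This is the sum of the flatness equations of s over all exponents. *)
Lemma rp_sum_flat s : finsupp s -> rp_flat s ->
  nabla1 (rp_sum s) = nabla2 (rp_sum s).
Proof.
move=> sf sE; rewrite /rp_sum (fsum_morph (nabla1_0 E) (@nabla1D _ E) sf).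
rewrite (fsum_morph (nabla2_0 E) (@nabla2D _ E) sf).
rewrite (reindex_fsbigT _ _ shift_bij); apply: eq_fsbigr => -[j k] _ /=.
by have /eqP := sE (j + 1) k; rewrite addrK subr_eq0 => /eqP ->.
Qed.

Lemma rp_sum_lmono_shift c i j k (r : nat) : i + j + k = 0 -> c \in W i ->
  rp_sum (lmono c i (j - r%:Z) (k + r%:Z)) = rp_sum (lmono c i j k).
Proof.
move=> ijk cW; elim: r => [|r IHr]; first by rewrite subr0 addr0.
rewrite -IHr -[RHS]rp_sum_shift -lmono_shift //; last by lia.
have -> : j - r.+1%:Z = j - r%:Z - 1 by lia.
by have -> : k + r.+1%:Z = k + r%:Z + 1 by lia.
Qed.

Lemma rp_sum_lmono_mul z c i j k (r : nat) : z.1 + z.2 = -1 ->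
    i + j + k = 0 -> c \in W i ->
  value z (rp_sum (lmono c (i + r%:Z) (j - r%:Z) k)) =
  value z (rp_sum (lmono c i j k)).
Proof.
move=> z12 ijk cW; elim: r => [|r IHr]; first by rewrite subr0 addr0.
have cWr : c \in W (i + r%:Z) by apply: mem_weight_le cW; lia.
have e : i + r%:Z + (j - r%:Z) + k = 0 by lia.
have [[sf _ _ _] _] := lmono12 e cWr.
rewrite -IHr -[RHS]rp_sum_mul // -lmono_mul //.
have -> : i + r.+1%:Z = i + r%:Z + 1 by lia.
by have -> : j - r.+1%:Z = j - r%:Z - 1 by lia.
Qed.

(** All monomials are 1 at v = (1,1,1), so only the vector c matters. The exponents (N, -N, 0) serve
    as a common reference, in which vectors of different weights can be added. *)
Lemma rp_sum_lmono z c i j k N : z.1 + z.2 = -1 -> i + j + k = 0 ->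
  c \in W i -> i <= N ->
  value z (rp_sum (lmono c i j k)) = value z (rp_sum (lmono c N (- N) 0)).
Proof.
move=> z12 ijk cW iN.
have i0 : i + - i + 0 = 0 by rewrite subrr.
have -> : N = i + `|N - i|%N%:Z by lia.
rewrite opprD (@rp_sum_lmono_mul z c i (- i) 0 `|N - i|%N z12 i0 cW).
suff -> : rp_sum (lmono c i j k) = rp_sum (lmono c i (- i) 0) by [].
(* Shifts move exponents from v_1 to v_2 only, so the sign of k decides which monomial is
   shifted. *)
have [k0|k0] := leP 0 k.
  rewrite -(rp_sum_lmono_shift `|k|%N i0 cW).
  have -> : - i - `|k|%N%:Z = j by lia.
  by have -> : 0 + `|k|%N%:Z = k by lia.
rewrite -(rp_sum_lmono_shift `|k|%N ijk cW).
have -> : j - `|k|%N%:Z = - i by lia.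
by have -> : k + `|k|%N%:Z = 0 by lia.
Qed.

End Lift.

(** * The fiber at the origin *)

Section FiberIdentification.
Variables (K : fieldType) (V : mhs K) (E : eqbun K).
Local Notation W := (@weight K V).
Local Notation F' := (@hodge1 K V).
Local Notation F'' := (@hodge2 K V).
Variable Phi : (int * int -> E) -> (int * int * int -> V).
Hypothesis hPhi : rees_iso Phi.
Variable iota : fiber E (0, 0) -> (int * int -> V).
Hypothesis hiota : fiber_identification Phi iota.
Hypothesis K_char0 : forall n, n.+1%:R != 0 :> K.
Implicit Types (s : int * int -> E) (z : K * K) (c v : V) (i j k p q : int)
  (x : int * int * int -> V) (jk pq : int * int) (e f : fiber E (0, 0)).

Lemma rp_section0 : rp_section U12 (fun=> 0 : E).
Proof.
apply: rp_section12.
- by apply: (@seq_finsupp _ _ _ [::]).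
- by move=> jk; rewrite eqxx.
- by move=> j k; rewrite nabla1_0 nabla2_0 subrr.
Qed.

Lemma Phi0 : Phi (fun=> 0) = (fun=> 0).
Proof.
have := rees_isoZ hPhi 0 rp_section0.
rewrite (_ : (fun jk : int * int => _) = (fun=> 0)); last first.
  by apply/funext => jk; rewrite scaler0.
by move=> ->; apply/funext => l; rewrite scale0r.
Qed.

Lemma iota_mem e p n : iota e (p, n - p) \in grpq V (p, n - p).
Proof. exact: (proj1 hiota). Qed.

Lemma iota0 pq : iota 0 pq = 0.
Proof.
case: pq => p q.
have := @grpq_direct _ V (p + q) (fun r => iota 0 (r, p + q - r)) (fun=> 0).
move=> /(_ (iota_mem 0 ^~ (p + q)))/(_ (fun r => mem0v _)).
have e0 : p + q - p + - (p + q) + p = 0 by lia.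
have e1 : p + q + - p + - q = 0 by lia.
have := proj2 hiota _ rp_section0 _ _ _ e1.
rewrite Phi0 linear0 => sum0 /(_ _ p); rewrite (_ : p + q - p = q); last by lia.
apply; rewrite [RHS]fsbig1 //; apply: etrans (esym sum0).
apply: eq_fsbigr => r _.
by rewrite value0.
Qed.

Lemma iota_concentrated s e : rp_section U12 s ->
    (forall jk, value (0, 0) (s jk) = if jk == (0, 0) then e else 0) ->
  forall p q, cls (W (p + q - 1)) (Phi s (p + q, - p, - q)) = iota e (p, q).
Proof.
move=> s12 se p q; have e0 : p + q + - p + - q = 0 by lia.
rewrite (proj2 hiota _ s12 _ _ _ e0) -[RHS](fsum_delta p); apply: eq_fsbigr => r _.
rewrite se; have [->|rp] := eqVneq r p.
  rewrite (_ : (- p + p, _) == (0, 0)) ?xpair_eqE; first by rewrite addrAC subrr add0r.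
  by apply/andP; split; apply/eqP; lia.
rewrite ifF ?iota0 //; apply/negbTE; rewrite xpair_eqE negb_and.
by apply/orP; left; move: rp; lia.
Qed.

(** Additivity is inherited from [Phi]: on a section whose only nonzero value at the origin is e, at
    exponent (0, 0), [iota e] is read off the coefficients of its image. *)
Lemma iotaD e f pq : iota (e + f) pq = iota e pq + iota f pq.
Proof.
case: pq => p q.
have [s s12 se] := flat_section_through K_char0 e.
have [t t12 tf] := flat_section_through K_char0 f.
have st12 := rp_sectionD s12 t12.
rewrite -(iota_concentrated s12 se) -(iota_concentrated t12 tf).
rewrite -(iota_concentrated (e := e + f) st12).
  by rewrite (rees_isoD hPhi s12 t12) linearD.
by move=> jk; rewrite valueD se tf; case: ifP; rewrite // addr0.
Qed.

(* If iota kills the value g at 0 of a section s, then Phi s is divisible by v_0,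
   hence g = 0. *)
Lemma iota_inj e f : iota e = iota f -> e = f.
Proof.
move=> ef; apply/eqP; rewrite -subr_eq0; apply/eqP.
have: forall pq, iota (e - f) pq = 0.
  by move=> pq; apply: (addIr (iota f pq)); rewrite -iotaD subrK add0r ef.
move: (e - f) => g g0 {e f ef}.
have [s s12 sg] := flat_section_through K_char0 g.
have [sdeg [N [sfin sN]]] := rees_iso_section hPhi s12.
(* The quotient of [Phi s] by v_0 / v_1. Its coefficients lie in the smaller weight step because
   their classes are components of [iota g], hence zero. *)
pose x (l : int * int * int) := Phi s (l.1.1 + 1, l.1.2 - 1, l.2).
have xsec : rees_section U12 x.
  split; first by move=> [[i j] k] /sdeg /=; lia.
  exists N; split.
    have [r _ r0] := finsupp_seq sfin.
    apply: (@seq_finsupp _ _ _ [seq (l.1.1 - 1, l.1.2 + 1, l.2) | l <- r]) => l lr.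
    have := r0 (l.1.1 + 1, l.1.2 - 1, l.2); rewrite /mul_mon /x /= => <-.
      by congr (Phi s (_, _, _)); lia.
    apply: contra lr => lr; apply/mapP; exists (l.1.1 + 1, l.1.2 - 1, l.2) => //=.
    by rewrite addrK subrK -!surjective_pairing.
  move=> i j k; have := sN (i + 1) (j - 1) k; rewrite /mul_mon /x /= !memv_cap.
  rewrite (_ : j - 1 - _ = j - (N * 1)%N%:Z - 1); last by lia.
  move=> /andP[/andP[_ xF'] ->]; rewrite andbT; apply/andP; split; last first.
    by apply: subvP xF'; apply: (proj1 (@hodge1_finite_decr _ V)); lia.
  set j' := j - _ - 1; set k' := k - _.
  have [->|] := eqVneq (Phi s (i + 1, j', k')) 0; first exact: mem0v.
  move=> /sdeg /= ijk; have := iota_concentrated s12 sg (- j') (- k').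
  rewrite !opprK g0 (_ : - j' - k' = i + 1); last by lia.
  by rewrite addrK => /eqP; rewrite cls0P.
have [t t12 tx] := rees_iso_surj hPhi xsec.
have st : s = rp_mul_v0v1 t.
  apply: (rees_iso_inj hPhi) => //; first exact: rp_mul_section.
  rewrite (rees_iso_v0v1 hPhi t12) tx; apply/funext => -[[i j] k].
  by rewrite /x /= subrK addrK.
have := sg (0, 0); rewrite eqxx => <-.
by rewrite st value_rp_mul /= cst0 !scale0r value0 addr0 oppr0.
Qed.

(** The class of the coefficient at (p' + q', -p', -q') is a sum of elements of the gr^{r, p'+q'-r},
    whose term r = p' is the (p', q') component sought. One extra step in either Hodge filtration
    forces that term to vanish. *)
Lemma iota_value_concentrated s p q v : rp_section U12 s ->
    cls (W (p + q - 1)) v \in grpq V (p, q) ->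
    cls (W (p + q - 1)) (Phi s (p + q, - p, - q)) = cls (W (p + q - 1)) v ->
    (forall p' q', (p', q') != (p, q) ->
       let w := cls (W (p' + q' - 1)) (Phi s (p' + q', - p', - q')) in
       w \in grW_fil W F' (p' + q') (p' + 1) \/
       w \in grW_fil W F'' (p' + q') (q' + 1)) ->
  iota (value (0, 0) (s (0, 0))) =
    (fun pq => if pq == (p, q) then cls (W (p + q - 1)) v else 0).
Proof.
move=> s12 vgr sv s0; apply/funext => -[p' q'].
pose w r := iota (value (0, 0) (s (- p' + r, - q' + (p' + q' - r)))) (r, p' + q' - r).
have e0 : p' + q' + - p' + - q' = 0 by lia.
have sumE := proj2 hiota _ s12 _ _ _ e0.
have wP r : w r \in grpq V (r, p' + q' - r) by exact: iota_mem.
have wp' : w p' = iota (value (0, 0) (s (0, 0))) (p', q').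
  rewrite /w addNr (_ : - q' + (p' + q' - p') = 0); last by lia.
  by rewrite (_ : p' + q' - p' = q') //; lia.
rewrite -wp'; case: eqP => [[pE qE]|/eqP pq].
  subst p' q'.
  have e1 : p + q - p = q by lia.
  rewrite (@grpq_direct _ V (p + q) w
    (fun r => if r == p then cls (W (p + q - 1)) v else 0)) ?eqxx //.
    by move=> r; case: eqP => [->|_]; [rewrite e1 | exact: mem0v].
  by rewrite fsum_delta -sv sumE.
have [x1|x2] := s0 p' q' pq.
  by apply: (@grpq_component1 _ V _ _ _ _ wP sumE x1); lia.
by apply: (@grpq_component2 _ V _ _ _ _ wP sumE x2); lia.
Qed.

(* s is regular at v_1 = 0 and s' at v_2 = 0.  Agreeing over the projective line
   of lines through z, they are constant there. *)
Lemma value_rp_sum_cross z s s' : rp_section U12 s -> rp_section U12 s' ->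
    (forall jk, jk.1 < 0 -> s jk = 0) -> (forall jk, jk.2 < 0 -> s' jk = 0) ->
    (forall jk, value z (s jk) = value z (s' jk)) ->
  value z (rp_sum s) = value z (s' (0, 0)) /\
  value z (rp_sum s') = value z (s (0, 0)).
Proof.
move=> [sf sdeg _ _] [s'f s'deg _ _] s0 s'0 ss'.
have vs jk : value z (s jk) = if jk == (0, 0) then value z (s (0, 0)) else 0.
  case: eqP => [-> //|/eqP jk0]; have [->|/sdeg sjk] := eqVneq (s jk) 0.
    exact: value0.
  have [j0|j0] := ltP jk.1 0; first by rewrite s0 // value0.
  rewrite ss' s'0 ?value0 //; case: jk jk0 sjk j0 => j k; rewrite xpair_eqE /=; lia.
have sumE t : finsupp t -> (forall jk, value z (t jk) = value z (s jk)) ->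
    value z (rp_sum t) = value z (s (0, 0)).
  move=> tf ts; rewrite /rp_sum (fsum_morph (value0 E z) (@valueD _ E z) tf).
  rewrite -[RHS](fsum_delta ((0, 0) : int * int)); apply: eq_fsbigr => jk _.
  by rewrite ts vs.
by split; rewrite ?sumE // -?ss'.
Qed.

End FiberIdentification.

(** * The Deligne splittings along the triangle *)

Section Pieces.
Variables (K : fieldType) (V : mhs K) (E : eqbun K).
Local Notation W := (@weight K V).
Local Notation F' := (@hodge1 K V).
Local Notation F'' := (@hodge2 K V).
Variable Phi : (int * int -> E) -> (int * int * int -> V).
Hypothesis hPhi : rees_iso Phi.
Variable iota : fiber E (0, 0) -> (int * int -> V).
Hypothesis hiota : fiber_identification Phi iota.
Hypothesis K_char0 : forall n, n.+1%:R != 0 :> K.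
Implicit Types (s : int * int -> E) (z : K * K) (c v : V) (i j k p q : int)
  (x : int * int * int -> V) (jk pq : int * int) (e f : fiber E (0, 0)).
Local Notation lmono := (lmono Phi).

Lemma rp_section_U1 s jk : rp_section U1 s -> jk.2 < 0 -> s jk = 0.
Proof.
move=> [_ _ [N sN] _] j0; apply/eqP; apply: contraLR j0 => /sN[_ /=].
by rewrite muln0 addr0 -leNgt.
Qed.

Lemma rp_section_U2 s jk : rp_section U2 s -> jk.1 < 0 -> s jk = 0.
Proof.
move=> [_ _ [N sN] _] j0; apply/eqP; apply: contraLR j0 => /sN[/= + _].
by rewrite muln0 addr0 -leNgt.
Qed.

Lemma rp_section_sum (n : nat) (S : nat -> int * int -> E) :
    (forall a, rp_section U12 (S a) ) ->
  rp_section U12 (fun jk => \sum_(a < n) S a jk) /\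
  Phi (fun jk => \sum_(a < n) S a jk) = (fun l => \sum_(a < n) Phi (S a) l).
Proof.
move=> S12; elim: n => [|n [IH12 IHPhi]].
  rewrite (_ : (fun jk => _) = fun=> 0); last by apply/funext => jk; rewrite big_ord0.
  split; first exact: rp_section0.
  by rewrite (Phi0 hPhi); apply/funext => l; rewrite big_ord0.
rewrite (_ : (fun jk => _) = fun jk => \sum_(a < n) S a jk + S n jk); last first.
  by apply/funext => jk; rewrite big_ord_recr.
split; first exact: rp_sectionD.
rewrite (rees_isoD hPhi IH12 (S12 n)) IHPhi.
by apply/funext => l; rewrite big_ord_recr.
Qed.

Lemma piece_class p q v w : v \in W (p + q) -> v \in F' p -> w \in W (p + q) ->
    w \in F'' q -> v - w \in W (p + q - 1) ->
  cls (W (p + q - 1)) v \in grpq V (p, q).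
Proof.
move=> vW vF' wW wF'' vw; apply/grpqP; split; apply/mem_grW_fil; first by exists v.
by exists w; split=> //; apply/eqP; rewrite cls_eq.
Qed.

(* With v = \sum_a u_a as in the definition of split1, v v_0^n v_1^-p v_2^-q and
   \sum_a u_a v_0^(n-a) v_1^-p v_2^(a-q) agree on the lines through (0,-1).  The
   second one restricts to the line v = (0,1,0), i.e. t_1 = 0. *)
Lemma split1_flat p q v : split1 (p, q) v -> exists m : E,
  [/\ nabla2 m = 0,
      iota (value (0, 0) m) =
        (fun pq => if pq == (p, q) then cls (W (p + q - 1)) v else 0) &
      value (0, -1) m = value (0, -1) (rp_sum (lmono v (p + q) (- p) (- q)))].
Proof.
move=> vpq; have [/=vW vF'] := deligne_piece_sub vpq.
have [N [u [u0W u0F uP vE]]] := deligne_piece_tail vpq.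
rewrite /= in u0W u0F uP.
have uW a : u a \in W (p + q - a%:Z).
  by case: a => [|a]; [rewrite subr0 | case: (uP a.+1)].
have uWn a : u a \in W (p + q) by apply: mem_weight_le (uW a); lia.
have uF a : u a \in F'' (q - a%:Z).
  case: a => [|a]; first by rewrite subr0.
  have [_] := uP a.+1 isT; apply: subvP; apply: (proj1 (@hodge2_finite_decr _ V)).
  by lia.
have deg0 : p + q + - p + - q = 0 by lia.
have degu (a : nat) : p + q - a%:Z + - p + (- q + a%:Z) = 0 by lia.
pose S (a : nat) := lmono (u a) (p + q - a%:Z) (- p) (- q + a%:Z).
have SU1 a : rp_section U1 (S a) /\
    Phi (S a) = mono (u a) (p + q - a%:Z) (- p) (- q + a%:Z).
  by apply: lmonoP => //= _; rewrite opprD opprK.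
have S12 a : rp_section U12 (S a) by apply: rp_section_sub (proj1 (SU1 a)).
have [s12 sPhi] := rp_section_sum N.+1 S12.
set s := (fun jk => _) in s12 sPhi.
have s0 jk : jk.2 < 0 -> s jk = 0.
  by move=> jk0; apply: big1 => a _; apply: rp_section_U1 jk0; case: (SU1 a).
have [||tU2 _] := lmonoP hPhi (U := U2) deg0 vW; [by rewrite opprK | by [] |].
have ts jk : value (0, -1) (lmono v (p + q) (- p) (- q) jk) = value (0, -1) (s jk).
  rewrite vE lmono_sum // /s !value_sum; apply: eq_bigr => a _.
  rewrite /S -lmono_at_v02 //; last by lia.
  by rewrite subrK.
exists (s (0, 0)); split.
(* Flatness equates [nabla2] of the coefficient at (0, 0) with [nabla1] of the one at (1, -1), which
   is zero as s is regular at v_2 = 0. *)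
- have [_ _ _ /(_ 1 0)] := s12; rewrite subrr sub0r (s0 (1, -1)) //.
  by rewrite nabla1_0 subr0.
- have vu0 : v - u 0%N \in W (p + q - 1).
    rewrite vE big_ord_recl addrAC subrr add0r; apply: rpred_sum => a _.
    by apply: mem_weight_le (uW _); rewrite lift0; lia.
  apply: (iota_value_concentrated hiota) => //; first exact: piece_class vu0.
    apply/eqP; rewrite sPhi cls_eq -opprB rpredN big_ord_recl.
    rewrite (proj2 (SU1 0%N)) /mono subr0 addr0 eqxx big1 ?addr0 // => a _.
    rewrite (proj2 (SU1 _)) /mono ifF //; apply/negbTE.
    by rewrite !xpair_eqE lift0; apply/negP => /andP[/andP[/eqP + _] _]; lia.
  (* Here the + 1 in Deligne's exponent is decisive: u_a sits at q' = q - a and lies in F''^(q-a+1),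
     one step deeper than its position. *)
  move=> p' q' pq /=; right.
  rewrite sPhi linear_sum; apply: rpred_sum => a _.
  rewrite (proj2 (SU1 a)) /mono; case: eqP => [[nE pE qE]|_]; last first.
    by rewrite linear0 mem0v.
  have a0 : (0 < a)%N.
    rewrite lt0n; apply: contra pq => /eqP a0; rewrite xpair_eqE.
    by rewrite a0 in qE; apply/andP; split; apply/eqP; lia.
  apply/mem_grW_fil; exists (u a); split=> //; first by rewrite nE.
  by have [_] := uP a a0; rewrite (_ : q - a%:Z + 1 = q' + 1) //; lia.
- have [-> _] := value_rp_sum_cross (rp_section_sub tU2) s12
    (fun jk => rp_section_U2 tU2) s0 ts.
  by [].
Qed.

(** The mirror image of [split1_flat]: v_1 and v_2 trade places, the tail is regular at v_1 = 0, and
    the comparison takes place on the lines through (-1,0), where v_0 = v_1. *)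
Lemma split2_flat p q v : split2 (p, q) v -> exists m : E,
  [/\ nabla1 m = 0,
      iota (value (0, 0) m) =
        (fun pq => if pq == (p, q) then cls (W (p + q - 1)) v else 0) &
      value (-1, 0) m = value (-1, 0) (rp_sum (lmono v (p + q) (- p) (- q)))].
Proof.
move=> vpq; have [/=vW vF''] := deligne_piece_sub vpq.
have [N [u [u0W u0F uP vE]]] := deligne_piece_tail vpq.
rewrite /= in u0W u0F uP.
rewrite (addrC q p) in vW u0W uP.
have uW a : u a \in W (p + q - a%:Z).
  by case: a => [|a]; [rewrite subr0 | case: (uP a.+1)].
have uWn a : u a \in W (p + q) by apply: mem_weight_le (uW a); lia.
have uF a : u a \in F' (p - a%:Z).
  case: a => [|a]; first by rewrite subr0.
  have [_] := uP a.+1 isT; apply: subvP; apply: (proj1 (@hodge1_finite_decr _ V)).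
  by lia.
have deg0 : p + q + - p + - q = 0 by lia.
have degu (a : nat) : p + q - a%:Z + (- p + a%:Z) + - q = 0 by lia.
pose S (a : nat) := lmono (u a) (p + q - a%:Z) (- p + a%:Z) (- q).
have SU2 a : rp_section U2 (S a) /\
    Phi (S a) = mono (u a) (p + q - a%:Z) (- p + a%:Z) (- q).
  by apply: lmonoP => //= _; rewrite opprD opprK.
have S12 a : rp_section U12 (S a) by apply: rp_section_sub (proj1 (SU2 a)).
have [s12 sPhi] := rp_section_sum N.+1 S12.
set s := (fun jk => _) in s12 sPhi.
have s0 jk : jk.1 < 0 -> s jk = 0.
  by move=> jk0; apply: big1 => a _; apply: rp_section_U2 jk0; case: (SU2 a).
have [||tU1 _] := lmonoP hPhi (U := U1) deg0 vW; [by [] | by rewrite opprK |].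
have ts jk : value (-1, 0) (lmono v (p + q) (- p) (- q) jk) = value (-1, 0) (s jk).
  rewrite vE lmono_sum // /s !value_sum; apply: eq_bigr => a _.
  rewrite /S -lmono_at_v01 //; last by lia.
  by rewrite subrK.
exists (s (0, 0)); split.
- have [_ _ _ /(_ 0 1)] := s12; rewrite subrr sub0r (s0 (-1, 1)) //.
  by rewrite nabla2_0 sub0r => /eqP; rewrite oppr_eq0 => /eqP.
- have vu0 : v - u 0%N \in W (p + q - 1).
    rewrite vE big_ord_recl addrAC subrr add0r; apply: rpred_sum => a _.
    by apply: mem_weight_le (uW _); rewrite lift0; lia.
  have uv0 : u 0%N - v \in W (p + q - 1) by rewrite -opprB rpredN.
  have clsE : cls (W (p + q - 1)) (u 0%N) = cls (W (p + q - 1)) v.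
    by apply/eqP; rewrite cls_eq.
  apply: (iota_value_concentrated hiota) => //; first by rewrite -clsE; exact: piece_class uv0.
    rewrite -clsE sPhi big_ord_recl.
    rewrite (proj2 (SU2 0%N)) /mono subr0 addr0 eqxx big1 ?addr0 // => a _.
    rewrite (proj2 (SU2 _)) /mono ifF //; apply/negbTE.
    by rewrite !xpair_eqE lift0; apply/negP => /andP[/andP[/eqP + _] _]; lia.
  move=> p' q' pq /=; left.
  rewrite sPhi linear_sum; apply: rpred_sum => a _.
  rewrite (proj2 (SU2 a)) /mono; case: eqP => [[nE pE qE]|_]; last first.
    by rewrite linear0 mem0v.
  have a0 : (0 < a)%N.
    rewrite lt0n; apply: contra pq => /eqP a0; rewrite xpair_eqE.
    by rewrite a0 in pE; apply/andP; split; apply/eqP; lia.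
  apply/mem_grW_fil; exists (u a); split=> //; first by rewrite nE.
  by have [_] := uP a a0; rewrite (_ : p - a%:Z + 1 = p' + 1) //; lia.
- have [_ ->] := value_rp_sum_cross s12 (rp_section_sub tU1)
    s0 (fun jk => rp_section_U1 tU1) (fun jk => esym (ts jk)).
  by [].
Qed.

Lemma rp_sum_lmonoD c c' i j k : i + j + k = 0 -> c \in W i -> c' \in W i ->
  rp_sum (lmono (c + c') i j k) = rp_sum (lmono c i j k) + rp_sum (lmono c' i j k).
Proof.
move=> ijk cW c'W; have [[cf _ _ _] _] := lmono12 hPhi ijk cW.
have [[c'f _ _ _] _] := lmono12 hPhi ijk c'W.
rewrite /rp_sum -fsumD //; apply: eq_fsbigr => jk _; exact: lmonoD.
Qed.

Lemma rp_sum_lmono0 i j k : i + j + k = 0 -> rp_sum (lmono 0 i j k) = 0.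
Proof.
by move=> ijk; rewrite /rp_sum fsbig1 // => jk _; exact: lmono0.
Qed.

Lemma decomposition_flat (split : int * int -> set V) (nabla : E -> E) z N :
    z.1 + z.2 = -1 -> W N = fullv ->
    nabla 0 = 0 -> (forall m m', nabla (m + m') = nabla m + nabla m') ->
    (forall pq v, split pq v -> v \in W (pq.1 + pq.2)) ->
    (forall p q v, split (p, q) v -> exists m : E,
      [/\ nabla m = 0,
          iota (value (0, 0) m) =
            (fun pq => if pq == (p, q) then cls (W (p + q - 1)) v else 0) &
          value z m = value z (rp_sum (lmono v (p + q) (- p) (- q)))]) ->
  forall v u, is_decomposition split v u -> exists m : E,
    [/\ nabla m = 0, iota (value (0, 0) m) = to_gr u &
        value z m = value z (rp_sum (lmono v N (- N) 0))].
Proof.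
move=> z12 WN nabla0 nablaD splitW pieces v u [us /finsupp_seq[r ur u0] vE].
have [m mP] := choice (fun pq => pieces pq.1 pq.2 (u pq)
  (eq_ind _ (fun pq' => split pq' (u pq)) (us pq) _ (surjective_pairing pq))).
exists (\sum_(pq <- r) m pq); split.
- by rewrite (big_morph _ nablaD nabla0) big1 // => pq _; case: (mP pq).
- apply/funext => pq.
  have iota_sum : iota (value (0, 0) (\sum_(l <- r) m l)) pq =
      \sum_(l <- r) iota (value (0, 0) (m l)) pq.
    rewrite value_sum; apply: (big_morph (iota^~ pq)); last first.
      exact: (@iota0 _ V E Phi hPhi iota hiota pq).
    by move=> e f; exact: (@iotaD _ V E Phi hPhi iota hiota K_char0 e f pq).
  rewrite iota_sum -[RHS](fsum_delta pq) -(fsum_seq ur).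
    apply: eq_fsbigr => l _; have [_ -> _] := mP l.
    rewrite -surjective_pairing eq_sym; case: eqP => [->|] //.
  move=> l lr; have [_ -> _] := mP l; rewrite u0 // linear0.
  by case: ifP.
- rewrite value_sum vE (fsum_seq ur u0).
  have N0 : N + - N + 0 = 0 by rewrite subrr.
  have inW c : c \in W N by rewrite WN memvf.
  have -> : rp_sum (lmono (\sum_(pq <- r) u pq) N (- N) 0) =
      \sum_(pq <- r) rp_sum (lmono (u pq) N (- N) 0).
    apply: (big_morph (fun c => rp_sum (lmono c N (- N) 0))).
      by move=> c c'; exact: rp_sum_lmonoD.
    exact: rp_sum_lmono0.
  rewrite value_sum; apply: eq_bigr => pq _; have [_ _ ->] := mP pq.
  have pqW := splitW _ _ (us pq).
  have deg0 : pq.1 + pq.2 + - pq.1 + - pq.2 = 0 by lia.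
  (* If p + q exceeds N, the vector already lies in W N, and both monomials are compared with the
     reference of weight p + q. *)
  have [pqN|Npq] := leP (pq.1 + pq.2) N.
    exact: (rp_sum_lmono hPhi z12 deg0 pqW pqN).
  rewrite (rp_sum_lmono hPhi z12 N0 (inW _) (ltW Npq)).
  exact: (rp_sum_lmono hPhi z12 deg0 pqW (lexx _)).
Qed.

Lemma flat_chain v u1 u2 : is_decomposition (@split1 K V) v u1 ->
    is_decomposition (@split2 K V) v u2 ->
  exists m1 m2 m3 : E,
    [/\ nabla2 m1 = 0, nabla1 m2 = nabla2 m2 & nabla1 m3 = 0] /\
    [/\ iota (value (0, 0) m1) = to_gr u1, iota (value (0, 0) m3) = to_gr u2,
        value (0, -1) m1 = value (0, -1) m2 &
        value (-1, 0) m2 = value (-1, 0) m3].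
Proof.
move=> u1P u2P; have [M [_ Wf]] := weight_bound V.
have WM := Wf M%:Z (lexx _).
have zx : ((0, -1) : K * K).1 + ((0, -1) : K * K).2 = -1 by rewrite /= add0r.
have zy : ((-1, 0) : K * K).1 + ((-1, 0) : K * K).2 = -1 by rewrite /= addr0.
have [|m1 [n1 i1 v1]] := decomposition_flat zx WM (nabla2_0 E) (@nabla2D _ E)
  _ split1_flat u1P.
  by move=> pq c /deligne_piece_sub[].
have [|m3 [n3 i3 v3]] := decomposition_flat zy WM (nabla1_0 E) (@nabla1D _ E)
  _ split2_flat u2P.
  by move=> pq c /deligne_piece_sub[]; rewrite addrC.
exists m1, (rp_sum (lmono v M%:Z (- M%:Z) 0)), m3; split; split=> //.
have deg0 : M%:Z + - M%:Z + 0 = 0 by rewrite subrr.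
have vM : v \in W M%:Z by rewrite WM memvf.
have [[sf _ _ sE] _] := lmono12 hPhi deg0 vM.
exact: rp_sum_flat.
Qed.

End Pieces.

(** * Existence and uniqueness of the holonomy around the triangle *)

Section TriangleHolonomy.
Variables (R : realType) (E : eqbun R[i]) (m1 m2 m3 : E).
Hypotheses (m1_flat : nabla2 m1 = 0) (m2_flat : nabla1 m2 = nabla2 m2)
  (m3_flat : nabla1 m3 = 0).
Hypotheses (m12 : value (0, -1) m1 = value (0, -1) m2)
  (m23 : value (-1, 0) m2 = value (-1, 0) m3).

Lemma triangle_holonomy_flat :
  triangle_holonomy (0, -1) (-1, 0) (value (0, 0) m1) (value (0, 0) m3).
Proof.
exists (value (0, -1) m1), (value (-1, 0) m3); split.
- exact: (flat_transport (along_vertical m1_flat)).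
- rewrite m12 -m23; exact: (flat_transport (along_diagonal m2_flat)).
- exact: (flat_transport (along_horizontal m3_flat)).
Qed.

Lemma triangle_holonomy_unique (e' : fiber E (0, 0)) :
  triangle_holonomy (0, -1) (-1, 0) (value (0, 0) m1) e' -> e' = value (0, 0) m3.
Proof.
move=> [ey [ez [t1 t2 t3]]].
have eyE := transport_unique (seg_dir_vertical _) (along_vertical m1_flat) t1 erefl.
rewrite m12 in eyE.
have ezE := transport_unique (seg_dir_diagonal _) (along_diagonal m2_flat) t2 eyE.
rewrite m23 in ezE.
exact: (transport_unique (seg_dir_horizontal _) (along_horizontal m3_flat) t3 ezE).
Qed.

End TriangleHolonomy.

(* The boundary of the triangle is run through clockwise:
   (0,0) -> (0,-1) -> (-1,0) -> (0,0).  With the opposite orientation one gets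
   the inverse of the Deligne operator. *)
Theorem theorem2p3p1 (R : realType) (V : mhs R[i]) (E : eqbun R[i])
    (Phi : (int * int -> E) -> (int * int * int -> V))
    (hPhi : rees_iso Phi)
    (iota : fiber E (0, 0) -> (int * int -> V))
    (hiota : fiber_identification Phi iota)
    (e e' : fiber E (0, 0)) :
  triangle_holonomy (0, -1) (-1, 0) e e' <->
  deligne_operator (iota e) (iota e').
Proof.
have chain := @flat_chain _ V E Phi hPhi iota hiota (@complex_char0 R).
have inj := @iota_inj _ V E Phi hPhi iota hiota (@complex_char0 R).
split=> [hol|[v [u1 u1P e1] [u2 u2P e2]]]; last first.
  have [m1 [m2 [m3 [[n1 n2 n3] [i1 i3 v12 v23]]]]] := chain v u1 u2 u1P u2P.
  have em1 : e = value (0, 0) m1 by apply: inj; exact: etrans e1 (esym i1).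
  have em3 : e' = value (0, 0) m3 by apply: inj; exact: etrans e2 (esym i3).
  subst e e'; exact: (triangle_holonomy_flat n1 n2 n3 v12 v23).
(* The vector v is the inverse image of [iota e] under a_{F'}. Its second decomposition yields a
   candidate for the end value, and uniqueness of transport identifies e' with it. *)
have [v [u1 [u1P e1]]] := split1_exists (proj1 hiota e).
have [u2 u2P] := split2_exists v.
have [m1 [m2 [m3 [[n1 n2 n3] [i1 i3 v12 v23]]]]] := chain v u1 u2 u1P u2P.
have em1 : e = value (0, 0) m1 by apply: inj; exact: etrans e1 (esym i1).
subst e.
have e'E := triangle_holonomy_unique n1 n2 n3 v12 v23 hol.
subst e'; exists v; first by exists u1.
by exists u2.
Qed.
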